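(* For any $\beta > 0$ there exists a large constant $K = K(\beta) > 0$ such that the following is true. For any $x$ that is large enough in terms of $\beta$, any $y$ with $(\log x)^{K} \leq y \leq x$, and any set $B \subseteq \mathcal{S}(y) \cap [1,x]$ such that $\#B \geq \beta \Psi(x,y)$, there exist integers $b$ and $d \neq 0$ such that $$ b,\; b+d,\; b+2d \in B . $$
   Context: Notation: $\mathcal{S}(y)$ is the set of $y$-smooth numbers, i.e. positive integers all of whose prime factors are $\leq y$. $\Psi(x,y) := \#\{n \leq x : n \in \mathcal{S}(y)\}$. *)

(* Defs.v *)
From mathcomp Require Import all_boot all_order all_algebra finmap.
From mathcomp Require Import boolp classical_sets functions cardinality reals exp.

Set Implicit Arguments.
Unset Strict Implicit.
Unset Printing Implicit Defensive.

Import Order.TTheory GRing.Theory Num.Theory.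

Local Open Scope classical_set_scope.
Local Open Scope ring_scope.

Definition smooth (R : realType) (y : R) : set int :=
  [set n : int | 0 < n /\
    forall p : nat, prime p -> (p%:Z %| n)%Z -> p%:R <= y].

(* [fset_set] sends infinite sets to [fset0], hence the cardinality below is
   meaningful only on finite sets; see [finite_smooth_le] and
   [finite_sub_smooth]. *)
Definition card_set (A : set int) : nat := #|` fset_set A|%fset.

Definition Psi (R : realType) (x y : R) : nat :=
  card_set (smooth y `&` [set n : int | n%:~R <= x]).

Lemma finite_smooth_le (R : realType) (x y : R) :
  finite_set (smooth y `&` [set n : int | n%:~R <= x]).
Proof.
apply: (@sub_finite_set _ _ (Posz @` `I_(Num.truncn x).+1)); last first.
  exact/finite_image/finite_II.
move=> n [[n0 _]] /= nx; exists `|n|%N; last by rewrite gez0_abs// ltW.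
rewrite -(gez0_abs (ltW n0)) -pmulrn in nx.
by rewrite /= ltnS truncn_ge_nat// (le_trans _ nx)// ler0n.
Qed.

Lemma finite_sub_smooth (R : realType) (x y : R) (B : set int) :
  B `<=` smooth y `&` [set n : int | (1 : R) <= n%:~R <= x] -> finite_set B.
Proof.
move=> sB; apply: sub_finite_set (finite_smooth_le x y) => n /sB[Sn /andP[_ nx]].
by split.
Qed.

(* Main.v *)
Require Import Defs.
From mathcomp Require Import all_boot all_order all_algebra finmap.
From mathcomp Require Import boolp classical_sets functions cardinality reals exp.
From mathcomp Require Import sequences.
From mathcomp Require Import zify ring lra.

(** The idea is to find, inside the smooth numbers, many dilates of dense
    subsets of intervals, and to apply Roth's theorem to one of them.

    Fix a threshold z that depends on beta only.  A y-smooth n is in exactly one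
    way a product m * j, where m has no prime factor up to z (the rough part)
    and j is z-smooth.  So the y-smooth numbers up to x are the disjoint union
    of the fibres m * {j z-smooth, j <= x / m}.  If T <= x / m <= z^U, then the
    fibre of m is a dilate of a subset of [1, x / m] whose density is at least
    a positive constant that depends on U only ([smooth_density]); if B has
    positive density in that fibre, Roth's theorem ([roth]) gives a progression
    in it.  By averaging ([good_fibre]) such a fibre exists as soon as nearly
    all the smooth numbers up to x lie in fibres with T <= x / m <= z^U.

    Write N(x) for the number of n <= x whose prime factors are all in (z, y].
    That nearly all fibres are good follows from two bounds, which say that
    N(x / q) is N(x) / q up to an absolute constant when q is bounded.
    - N(x) <= 1000 q N(x / q) ([count_sieved_div_lower]).  Summed over q <= z it
      shows that only a proportion O(1 / log z) of the smooth numbers are rough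
      ([rough_sparse]), hence that the fibres with x / m < T carry little.
    - q N(x / q) <= 1000 N(x) ([count_sieved_div_upper]).  Used with z = 0 it
      bounds the mean of the logarithm of the z-smooth part by O(log z), and by
      Markov's inequality the fibres with x / m > z^U carry little if U is
      large, however z is chosen afterwards ([long_fibres]).

    Both bounds compare the sum of log p over the pairs p | n, n <= x, with the
    same sum for x / q.  Grouping the pairs by m = n / p, the sum is that of
    theta(min(y, x / m)), to which Chebyshev's estimates apply.  It is also
    about N(x) log x, because the numbers divisible by a large square are rare
    ([light_rare]).  For the second bound the primes in (y / q, y] have to be
    left out, since theta(min(y, x / m)) does not decrease when x is replaced
    by x / q and x / m > q y.  The bound then needs that a typical n does not
    have most of its logarithm in these primes ([rich_rare]), and this is where
    y >= (log x)^K with K large is used.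

    To prove it, take n with many prime factors in (y / Q, y].  Exchange g of
    them for g primes of (y / s^2, y / s], for some s much larger than Q, and for
    one more prime that fills the room left.  The result is still at most x, and
    an exchange can be done in more ways than it can be undone: the ratio is
    (c log s / log Q)^g / (log x log y).  Taking g proportional to log y makes
    this large when log x is at most y^(1/K); when log x <= (log y)^2, g = 4 and
    s a small power of y suffice.

    Roth's theorem is proved by Szemeredi's combinatorial argument
    ([no_critical_density]), which uses the density of the extremal sets and
    Hilbert cubes.

    Counts are natural numbers, and logarithms are mostly integer parts of
    binary logarithms. *)

Set Implicit Arguments.
Unset Strict Implicit.
Unset Printing Implicit Defensive.

Import Order.TTheory GRing.Theory Num.Theory.

Local Open Scope nat_scope.

(** * Binary logarithms *)

Local Notation lg := (trunc_log 2).

Lemma lg_le n : 0 < n -> 2 ^ lg n <= n.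
Proof. exact: trunc_logP. Qed.

Lemma lg_gt n : n < 2 ^ (lg n).+1.
Proof. exact: trunc_log_ltn. Qed.

Lemma lg_prime_gt0 p : prime p -> 0 < lg p.
Proof. by move=> /prime_gt1 p1; rewrite trunc_log_gt0. Qed.

Lemma lg_lt_exp n k : n < 2 ^ k -> 0 < k -> lg n < k.
Proof.
case: n => [|n nk k0]; first by rewrite trunc_log0.
by rewrite -(ltn_exp2l (m := 2)) // (leq_ltn_trans _ nk) // lg_le.
Qed.

Lemma lgM_leq m n : lg (m * n) <= (lg m + lg n).+1.
Proof.
rewrite -ltnS; apply: lg_lt_exp => //.
have -> : (lg m + lg n).+2 = (lg m).+1 + (lg n).+1 by rewrite addnS addSn.
by rewrite expnD ltn_mul ?lg_gt.
Qed.

Lemma ltn_lg n : 0 < n -> lg n < n.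
Proof. by move=> n0; apply: leq_trans (lg_le n0); apply: ltn_expl. Qed.

(** Halving n squares the power of 2, which absorbs one more factor n. *)
Lemma exp2_dominates k c : exists n0, forall n, n0 <= n -> c * n ^ k <= 2 ^ n.
Proof.
elim: k c => [|k IH] c.
  exists c => n cn; rewrite expn0 muln1; apply: leq_trans cn _.
  exact/ltnW/ltn_expl.
have [n0 Hn0] := IH (c * 3 ^ k.+1).
exists (n0.*2 + 2) => n nn0.
have nE := odd_double_half n; set m := n./2 in nE.
have mn0 : n0 <= m by case: (odd n) nE => /= nE; lia.
have n3 : n <= 3 * m by case: (odd n) nE => /= nE; lia.
apply: (@leq_trans ((c * 3 ^ k.+1 * m ^ k) * m)).
  rewrite -!mulnA -expnSr -expnMn leq_mul2l.
  by rewrite leq_exp2r // n3 orbT.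
apply: (@leq_trans (2 ^ m * 2 ^ m)).
  apply: leq_mul; first exact: Hn0.
  exact/ltnW/ltn_expl.
rewrite -expnD leq_exp2l //.
by case: (odd n) nE => /= nE; lia.
Qed.

Lemma lg_dominated k c : exists n0, forall n, n0 <= n -> c * lg n ^ k <= n.
Proof.
have [l0 Hl0] := exp2_dominates k c.
exists (2 ^ l0) => n nl0.
have n_gt0 : 0 < n by apply: leq_trans nl0; rewrite expn_gt0.
apply: leq_trans (lg_le n_gt0); apply: Hl0.
exact: trunc_log_max.
Qed.

Lemma leq_sum_pred (I : eqType) (r : seq I) (P Q : pred I) (F : I -> nat) :
  (forall i, P i -> Q i) -> \sum_(i <- r | P i) F i <= \sum_(i <- r | Q i) F i.
Proof.
move=> PQ; rewrite big_mkcond [leqRHS]big_mkcond /=.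
by apply: leq_sum => i _; case: ifP => // /PQ ->.
Qed.

(** The primes are introduced in increasing order, each coprime to the
    product of the previous ones. *)
Lemma prod_prime_dvd n M :
  \prod_(0 <= p < n | prime p && (p %| M)) p %| M.
Proof.
elim: n => [|n IH]; first by rewrite big_geq.
rewrite big_mkcond big_nat_recr //= -big_mkcond /=.
case: ifP => [/andP[pn nM]|_]; last by rewrite muln1.
rewrite Gauss_dvd ?IH //.
rewrite big_nat_cond.
apply: (big_ind (fun m => coprime m n)) => //.
- exact: coprime1n.
- by move=> a b ca cb; rewrite coprimeMl ca.
- move=> p /and3P[/andP[_ pn'] pp _].
  by rewrite prime_coprime // dvdn_prime2 // ltn_eqF.
Qed.

Lemma exp2_sum_lg (r : seq nat) (P : pred nat) :
  (forall p, P p -> 0 < p) ->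
  2 ^ (\sum_(p <- r | P p) lg p) <= \prod_(p <- r | P p) p.
Proof.
move=> P0; apply: (big_ind2 (fun a b => 2 ^ a <= b)) => //.
- by move=> a b c d ab cd; rewrite expnD leq_mul.
- by move=> p /P0; apply: lg_le.
Qed.

(** Rounding log p down loses at most a factor 2, as lg p >= 1 for a prime. *)
Lemma prod_lt_exp2_sum_lg (r : seq nat) (P : pred nat) :
  (forall p, P p -> prime p) ->
  \prod_(p <- r | P p) p <= 2 ^ (\sum_(p <- r | P p) lg p).*2.
Proof.
move=> Pp; apply: (big_ind2 (fun a b => a <= 2 ^ b.*2)) => //.
- by move=> a b c d ab cd; rewrite doubleD expnD leq_mul.
- move=> p /Pp pp; apply: (leq_trans (ltnW (lg_gt p))); rewrite leq_exp2l //.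
  by have := lg_prime_gt0 pp; lia.
Qed.

Lemma sum_lg_dvd n M : 0 < M ->
  \sum_(0 <= p < n | prime p && (p %| M)) lg p <= lg M.
Proof.
move=> M0; apply: trunc_log_max => //.
apply: leq_trans (dvdn_leq M0 (prod_prime_dvd n M)).
by apply: exp2_sum_lg => p /andP[/prime_gt0].
Qed.

(** * Chebyshev's upper bound *)

Definition theta n := \sum_(0 <= p < n.+1 | prime p) lg p.

Definition nprimes n := \sum_(0 <= p < n.+1 | prime p) 1.

Lemma bin_double_le n : 'C(n.*2, n) <= 2 ^ n.*2.
Proof.
rewrite -[2]/(1 + 1) expnDn (bigD1 (inord n : 'I_n.*2.+1)) //=.
by rewrite inordK ?ltnS -?addnn ?leq_addr // !exp1n !muln1 leq_addr.
Qed.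

Lemma prime_dvd_bin_double n p : prime p -> n < p <= n.*2 -> p %| 'C(n.*2, n).
Proof.
move=> pp /andP[np p2n].
have nn2 : n <= n.*2 by rewrite -addnn leq_addr.
have := bin_fact nn2; rewrite -[in (_ - _)%N]addnn addnK => E.
have : p %| (n.*2)`! by rewrite dvdn_fact // prime_gt0.
rewrite -E !Euclid_dvdM //.
suff /negbTE -> : ~~ (p %| n`!) by rewrite !orbF.
have nfact m : m < p -> ~~ (p %| m`!).
  elim: m => [|m IH] mp; first by rewrite dvdn1; case: eqP pp => // ->.
  rewrite factS Euclid_dvdM // negb_or IH ?(ltnW mp) // andbT.
  by apply/negP => /(dvdn_leq (ltn0Sn m)); rewrite leqNgt mp.
exact: nfact.
Qed.

(** The primes in (n, 2n] divide the central binomial coefficient, which is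
    at most 4^n. *)
Lemma theta_double n : theta n.*2 <= theta n + n.*2.
Proof.
rewrite /theta (@big_cat_nat _ _ _ n.+1) //=; last by rewrite ltnS -addnn leq_addr.
rewrite leq_add2l.
apply: (@leq_trans (lg 'C(n.*2, n))); last first.
  apply: leq_trans (leq_trunc_log 2 (bin_double_le n)) _.
  by rewrite trunc_expnK.
have b0 : 0 < 'C(n.*2, n) by rewrite bin_gt0 -addnn leq_addr.
apply: leq_trans (sum_lg_dvd n.*2.+1 b0).
rewrite [leqRHS](@big_cat_nat _ _ _ n.+1) //=; last by rewrite ltnS -addnn leq_addr.
apply: leq_trans (leq_addl _ _).
rewrite big_nat_cond [leqRHS]big_nat_cond.
apply: leq_sum_pred => p /andP[/andP[np p2n] pp].
by rewrite np p2n pp prime_dvd_bin_double // np.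
Qed.

Lemma theta_mono m n : m <= n -> theta m <= theta n.
Proof.
move=> mn; rewrite /theta [leqRHS](@big_cat_nat _ _ _ m.+1) //=.
exact: leq_addr.
Qed.

Lemma theta_le n : theta n <= 4 * n.
Proof.
elim/ltn_ind: n => -[|[|n]] IH.
- by rewrite /theta big_mkcond !big_nat_recr //= big_geq.
- by rewrite /theta big_mkcond !big_nat_recr //= big_geq.
have E := odd_double_half n.
have h : (n./2).+1 + odd n < n.+2 by case: (odd n) E => /= E; lia.
have {}IH := IH _ h.
have D := theta_double ((n./2).+1 + odd n).
have M : theta n.+2 <= theta ((n./2).+1 + odd n).*2.
  by apply: theta_mono; case: (odd n) E => /= E; lia.
by case: (odd n) E IH D M => /= E IH D M; lia.
Qed.

(** * Chebyshev's bounds for the number of primes *)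

Lemma bin_double_ge m : 0 < m -> 2 ^ m.*2 <= m.*2 * 'C(m.*2, m).
Proof.
elim: m => // -[|m] IH _; first by [].
have {}IH := IH isT; move: (m.+1) IH => {}m IH.
have E1 := mul_bin_down m.*2.+1 m.
have E2 := mul_bin_diag m.*2.+1.+1 m.
have h1 : m.*2.+1 - m = m.+1 by rewrite -addnn; lia.
rewrite h1 /= in E1; rewrite /= in E2.
have E3 : 'C(m.*2.+2, m.+1) = 2 * 'C(m.*2.+1, m).
  apply/eqP; rewrite -(eqn_pmul2l (ltn0Sn m)) -E2 mulnA; apply/eqP; congr (_ * _).
  by rewrite -addnn; lia.
rewrite doubleS E3 !expnS mulnA.
have -> : m.*2.+2 * (2 * 'C(m.*2.+1, m)) = 4 * (m.+1 * 'C(m.*2.+1, m)) by rewrite -addnn; lia.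
rewrite -E1; apply: leq_mul => //.
by apply: leq_trans IH _; rewrite leq_mul2r leqnSn orbT.
Qed.

(** In Legendre's formula each power p^k <= 2m contributes at most 1 to the
    valuation of the central binomial coefficient, and larger powers nothing. *)
Lemma logn_bin_double m p : prime p -> logn p 'C(m.*2, m) <= trunc_log p m.*2.
Proof.
move=> pp; have p1 := prime_gt1 pp; have p0 := prime_gt0 pp.
have nn2 : m <= m.*2 by rewrite -addnn leq_addr.
have := bin_fact nn2; rewrite -[in (_ - _)%N]addnn addnK => E.
have b0 : 0 < 'C(m.*2, m) by rewrite bin_gt0.
have := congr1 (logn p) E.
rewrite !lognM ?muln_gt0 ?fact_gt0 // !logn_fact //.
have -> : \sum_(1 <= k < m.+1) m %/ p ^ k = \sum_(1 <= k < m.*2.+1) m %/ p ^ k.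
  rewrite [RHS](@big_cat_nat _ _ _ m.+1) //=.
  rewrite [X in _ + X]big_nat_cond [X in _ + X]big1 ?addn0 // => k /andP[/andP[mk _] _].
  by rewrite divn_small // (leq_trans mk) // ltnW // ltn_expl.
move=> E'.
have : \sum_(1 <= k < m.*2.+1) m.*2 %/ p ^ k <=
   \sum_(1 <= k < m.*2.+1) ((k <= trunc_log p m.*2) + (m %/ p ^ k).*2).
  apply: leq_sum => k _.
  have pk : 0 < p ^ k by rewrite expn_gt0 p0.
  have [_|kt] := leqP k (trunc_log p m.*2).
    apply: (@leq_trans (1 + (m %/ p ^ k).*2)) => //.
    have : m.*2 %/ p ^ k < (m %/ p ^ k).*2.+2; last by lia.
    rewrite ltn_divLR //.
    have := divn_eq m (p ^ k); have := ltn_pmod m pk.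
    set q := m %/ _; set r := m %% _; set P := p ^ k => rP mE.
    by rewrite mE; nia.
  rewrite divn_small //; apply: leq_trans (trunc_log_ltn _ p1) _.
  by rewrite leq_exp2l.
rewrite big_split /= -E' -(big_morph _ doubleD (erefl : 0.*2 = 0)).
have : \sum_(1 <= k < m.*2.+1) (k <= trunc_log p m.*2) <= trunc_log p m.*2.
  have [tl|tl] := leqP (trunc_log p m.*2) m.*2.
    rewrite (@big_cat_nat _ _ _ (trunc_log p m.*2).+1) //=.
    rewrite [X in _ + X]big_nat_cond [X in _ + X]big1 ?addn0; last first.
      by move=> k /andP[/andP[mk _] _]; rewrite leqNgt mk.
    apply: (@leq_trans (\sum_(1 <= i < (trunc_log p m.*2).+1) 1)).
      by apply: leq_sum => k _; exact: leq_b1.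
    by rewrite sum_nat_const_nat subn1 muln1.
  apply: (@leq_trans (\sum_(1 <= i < m.*2.+1) 1)).
    by apply: leq_sum => k _; exact: leq_b1.
  by rewrite sum_nat_const_nat subn1 muln1 ltnW.
set A := \sum_(1 <= k < _) nat_of_bool _; set B := \sum_(_ <= _ < _) m %/ _; lia.
Qed.

Lemma count_prime_le (P : pred nat) v n :
  (forall p, P p -> prime p && (p <= v)) ->
  count P (index_iota 0 n) <= nprimes v.
Proof.
move=> Pv; rewrite /nprimes sum1_count -!size_filter uniq_leq_size //.
  by rewrite filter_uniq // iota_uniq.
move=> p; rewrite !mem_filter !mem_index_iota => /andP[/Pv /andP[-> pv] _].
by rewrite ltnS.
Qed.

Lemma bin_double_le_nprimes m : 0 < m -> 'C(m.*2, m) <= m.*2 ^ nprimes m.*2.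
Proof.
move=> m0; set M := 'C(_, _).
have M0 : 0 < M by rewrite bin_gt0 -addnn leq_addr.
rewrite -(partnT M0) (widen_partn (m := maxn M m.*2)) ?leq_maxl //.
apply: (@leq_trans (\prod_(0 <= p < (maxn M m.*2).+1 | prime p && (p <= m.*2)) m.*2)).
  rewrite [leqRHS]big_mkcond /=; apply: leq_prod => p _.
  case: ifP => [/andP[pp _]|npp].
    rewrite -[leqRHS](muln1) (leq_trans (_ : _ <= p ^ trunc_log p m.*2)) //.
      by rewrite leq_exp2l ?prime_gt1 // logn_bin_double.
    by rewrite muln1 trunc_logP ?prime_gt1 // double_gt0.
  suff -> : logn p M = 0 by rewrite expn0.
  apply/eqP; rewrite eqn0Ngt logn_gt0 mem_primes M0 /=; apply/negP => /andP[pp pM].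
  rewrite pp /= in npp.
  have : logn p M <= trunc_log p m.*2 by apply: logn_bin_double.
  have : 0 < logn p M by rewrite logn_gt0 mem_primes pp M0.
  move=> l1 l2; have := leq_trans l1 l2; rewrite trunc_log_gt0 => /andP[_].
  by rewrite (prednK (prime_gt0 pp)) npp.
rewrite big_const_seq iter_muln_1 leq_pexp2l ?double_gt0 //.
by apply: count_prime_le => p /andP[-> ->].
Qed.

Lemma nprimes_mono m n : m <= n -> nprimes m <= nprimes n.
Proof.
move=> mn; rewrite /nprimes [leqRHS](@big_cat_nat _ _ _ m.+1) //=.
exact: leq_addr.
Qed.

Lemma nprimes_gt0 n : 1 < n -> 0 < nprimes n.
Proof.
move=> n1; apply: leq_trans (nprimes_mono n1).
by rewrite /nprimes big_mkcond !big_nat_recr //= big_geq.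
Qed.

Lemma nprimes_lower n : 1 < n -> n <= 5 * lg n * nprimes n.
Proof.
move=> n1; set m := n./2.
have nE := odd_double_half n; rewrite -/m in nE.
have m0 : 0 < m by case: (odd n) nE => /= nE; lia.
have b1 := bin_double_ge m0; have b2 := bin_double_le_nprimes m0.
have mn : m.*2 <= n by case: (odd n) nE => /= nE; lia.
have mn' : n <= m.*2.+1 by case: (odd n) nE => /= nE; lia.
have l0 : 0 < lg n by rewrite trunc_log_gt0.
have p0 := nprimes_gt0 n1.
have : m.*2 < (lg m.*2).+1 * (nprimes m.*2).+1.
  rewrite -(ltn_exp2l (m := 2)) // expnM.
  apply: (@leq_ltn_trans (m.*2 ^ (nprimes m.*2).+1)).
    by rewrite expnS; apply: leq_trans b1 _; rewrite leq_mul2l b2 orbT.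
  by rewrite ltn_exp2r // lg_gt.
have := leq_trunc_log 2 mn; have := nprimes_mono mn.
set a := lg m.*2; set b := lg n in l0 *; set c := nprimes m.*2; set d := nprimes n in p0 *.
move=> cd ab H.
have : m.*2 < b.+1 * d.+1 by apply: leq_trans H _; apply: leq_mul.
nia.
Qed.

Lemma sum_ltn_le a n : \sum_(0 <= p < n) (p < a) <= a.
Proof.
suff -> : \sum_(0 <= p < n) (p < a) = minn a n by exact: geq_minl.
elim: n => [|n IH]; first by rewrite big_geq // minn0.
rewrite big_nat_recr //= IH /minn.
by case: (ltnP a n) => h1; case: (ltnP a n.+1) => h2; case: (ltnP n a) => h3 /=; lia.
Qed.

Lemma nprimes_split h n :
  nprimes n <= h + \sum_(0 <= p < n.+1 | prime p && (h <= p)) 1.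
Proof.
apply: (@leq_trans (\sum_(0 <= p < n.+1) (p < h) +
    \sum_(0 <= p < n.+1 | prime p && (h <= p)) 1)); last first.
  by rewrite leq_add2r sum_ltn_le.
rewrite /nprimes big_mkcond [X in _ + X]big_mkcond -big_split /=.
by apply: leq_sum => p _; case: (prime p) => //=; case: (leqP h p).
Qed.

Lemma theta_ge_count h n z : z < 2 ^ h ->
  h * nprimes n <= h * 2 ^ h + \sum_(0 <= p < n.+1 | prime p && (z < p)) lg p.
Proof.
move=> zh; apply: (@leq_trans (h * (2 ^ h +
    \sum_(0 <= p < n.+1 | prime p && (2 ^ h <= p)) 1))).
  by rewrite leq_mul2l nprimes_split orbT.
rewrite mulnDr leq_add2l big_distrr /=.
apply: (@leq_trans (\sum_(0 <= p < n.+1 | prime p && (2 ^ h <= p)) lg p)).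
  apply: leq_sum => p /andP[_ hp]; rewrite muln1; exact: trunc_log_max.
by apply: leq_sum_pred => p /andP[-> hp] /=; apply: leq_trans hp.
Qed.

Lemma uphalf_bounds m : m <= (uphalf m).*2 <= m.+1.
Proof.
by have := odd_double_half m; rewrite uphalf_half; case: (odd m) => /= E; lia.
Qed.

(** The primes below about sqrt n are too few to matter, and the others have
    logarithm at least half of that of n. *)
Lemma nprimes_upper n : nprimes n * lg n <= 12 * n.
Proof.
have [|n1] := leqP n 1; first by case: n => [|[|]]; rewrite ?trunc_log0 ?trunc_log1 ?muln0.
have n0 : 0 < n by apply: leq_trans n1.
set h := uphalf (lg n).
have hE : lg n <= h.*2 <= (lg n).+1 by exact: uphalf_bounds.
have := theta_ge_count n (expn_gt0 2 h : 0 < 2 ^ h).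
have : \sum_(0 <= p < n.+1 | prime p && (0 < p)) lg p <= 4 * n.
  by apply: leq_trans (theta_le n); apply: leq_sum_pred => p /andP[].
have : h * 2 ^ h <= 2 * n.
  apply: (@leq_trans (2 ^ h.*2)).
    by rewrite -addnn expnD leq_mul2r orbC ltnW // ltn_expl.
  apply: (@leq_trans (2 ^ (lg n).+1)); first by rewrite leq_exp2l //; lia.
  by rewrite expnS leq_mul2l lg_le.
set A := h * 2 ^ h; set B := \sum_(_ <= _ < _ | _) _; set C := nprimes n; nia.
Qed.

(** Chebyshev's bound in the weighted form that the comparison of N(x) and
    N(x / q) uses: discarding the primes up to a fixed z costs nothing for large n. *)
Lemma theta_gt_lower z : exists r0, forall n, r0 <= n ->
  n <= 20 * \sum_(0 <= p < n.+1 | prime p && (z < p)) lg p.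
Proof.
have [h0 Hh0] := exp2_dominates 1 40.
exists (2 ^ (h0.*2 + z.*2 + 2)) => n rn.
have n1 : 1 < n by apply: leq_trans rn; rewrite -{1}(expn0 2) ltn_exp2l //; lia.
have n0 : 0 < n by apply: leq_trans n1.
have ln : h0.*2 + z.*2 + 2 <= lg n by apply: trunc_log_max.
set h := uphalf (lg n).
have hE : lg n <= h.*2 <= (lg n).+1 by exact: uphalf_bounds.
have zh : z < 2 ^ h by apply: leq_trans (ltn_expl z (isT : 1 < 2)) _; rewrite leq_exp2l //; lia.
have := theta_ge_count n zh; have := nprimes_lower n1.
have : 40 * h * 2 ^ h <= 2 * n.
  apply: (@leq_trans (2 ^ h.*2)).
    rewrite -addnn expnD leq_mul2r -[h in 40 * h]expn1 Hh0 ?orbT //; lia.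
  apply: (@leq_trans (2 ^ (lg n).+1)); first by rewrite leq_exp2l //; lia.
  by rewrite expnS leq_mul2l lg_le.
set A := 2 ^ h; set B := \sum_(_ <= _ < _ | _) _; set C := nprimes n; nia.
Qed.

Lemma nprimes_gt_lower z : exists r0, forall n, r0 <= n ->
  n <= 10 * lg n * \sum_(0 <= p < n.+1 | prime p && (z < p)) 1.
Proof.
have [r0 H0] := lg_dominated 1 (10 * z.+1).
exists (r0 + 2) => n rn.
have n1 : 1 < n by lia.
have := nprimes_lower n1; have := nprimes_split z.+1 n.
have : 10 * z.+1 * lg n <= n by rewrite -{1}(expn1 (lg n)) H0 //; lia.
set B := \sum_(_ <= _ < _ | _) _; set C := nprimes n; nia.
Qed.

(** The factor 256 is large enough for the lower bound at 256 t to beat the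
    upper bound at t. *)
Lemma nprimes_interval t : 8 <= lg t ->
  t <= lg t * \sum_(0 <= p < (256 * t).+1 | prime p && (t < p)) 1.
Proof.
move=> lt8; have t1 : 1 < t by case: t lt8 => [|[|]]; rewrite ?trunc_log0 ?trunc_log1.
have t0 : 0 < t by lia.
have bt1 : 1 < 256 * t by lia.
have := nprimes_lower bt1.
have -> : lg (256 * t) = lg t + 8.
  have : 2 ^ (lg t + 8) <= 256 * t < 2 ^ (lg t + 8).+1.
    have h8 : 2 ^ 8 = 256 by [].
    have := lg_le t0; have := lg_gt t.
    rewrite -addSn !expnD h8; set A := 2 ^ lg t; set A' := 2 ^ (lg t).+1; lia.
  exact: trunc_log_eq.
have := nprimes_upper t.
have : nprimes (256 * t) <= nprimes t + \sum_(0 <= p < (256 * t).+1 | prime p && (t < p)) 1.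
  rewrite /nprimes big_mkcond (@big_cat_nat _ _ _ t.+1) //=; last by lia.
  rewrite -big_mkcond leq_add2l /= -big_mkcond /=.
  rewrite [leqRHS](@big_cat_nat _ _ _ t.+1) //=; last by lia.
  apply: leq_trans (leq_addl _ _).
  rewrite big_nat_cond [leqRHS]big_nat_cond.
  by apply: leq_sum_pred => p /andP[/andP[-> ->] ->].
set B := \sum_(_ <= _ < _ | _) _; set C := nprimes t; set D := nprimes _ => H1 H2 H3.
have : 256 * t <= 5 * (lg t + 8) * (C + B) by apply: leq_trans H3 _; rewrite leq_mul2l H1 orbT.
nia.
Qed.

(** * Numbers with all prime factors in an interval *)

(** [sieved 0 y] is y-smoothness, and [sieved z y] adds z-roughness.  Both bounds
    are kept because the two growth bounds are needed for rough smooth numbers too. *)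
Definition sieved z y n := (0 < n) && all (fun p => z < p <= y) (primes n).

Definition count_sieved z y x := \sum_(1 <= n < x.+1) sieved z y n.

Definition prime_in z y p := prime p && (z < p <= y).

Lemma sievedP z y n :
  reflect (0 < n /\ forall p, prime p -> p %| n -> z < p <= y) (sieved z y n).
Proof.
apply: (iffP andP) => -[n0 H]; split=> //.
  by move=> p pp pn; apply: (allP H); rewrite mem_primes pp n0.
by apply/allP => p; rewrite mem_primes => /and3P[pp _ pn]; apply: H.
Qed.

Lemma sieved_gt0 z y n : sieved z y n -> 0 < n.
Proof. by case/andP. Qed.

Lemma sievedM z y m n : sieved z y (m * n) = sieved z y m && sieved z y n.
Proof.
apply/sievedP/andP => [[mn0 H]|[/sievedP[m0 Hm] /sievedP[n0 Hn]]].
  move: mn0; rewrite muln_gt0 => /andP[m0 n0].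
  split; apply/sievedP; split=> // p pp pd; apply: H => //.
    exact: dvdn_mulr.
  exact: dvdn_mull.
split; first by rewrite muln_gt0 m0.
by move=> p pp; rewrite Euclid_dvdM // => /orP[]; [apply: Hm|apply: Hn].
Qed.

Lemma sieved_dvd z y d n : d %| n -> sieved z y n -> sieved z y d.
Proof. by case/dvdnP => k ->; rewrite sievedM => /andP[]. Qed.

Lemma sieved_prime z y p : prime_in z y p -> sieved z y p.
Proof.
case/andP => pp zpy; apply/sievedP; split; first exact: prime_gt0.
by move=> q qq; rewrite dvdn_prime2 // => /eqP ->.
Qed.

Lemma count_sieved_mono z y m n : m <= n -> count_sieved z y m <= count_sieved z y n.
Proof.
move=> mn; rewrite /count_sieved [leqRHS](@big_cat_nat _ _ _ m.+1) //=.
exact: leq_addr.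
Qed.

Lemma count_sieved_le z y x : count_sieved z y x <= x.
Proof.
apply: (@leq_trans (\sum_(1 <= n < x.+1) 1)).
  by apply: leq_sum => n _; exact: leq_b1.
by rewrite sum_nat_const_nat subn1 muln1.
Qed.

Lemma sum_multiples d x (g : nat -> nat) : 0 < d ->
  \sum_(1 <= n < x.+1) (d %| n) * g n = \sum_(1 <= m < (x %/ d).+1) g (d * m).
Proof.
move=> d0; elim: x => [|x IH]; first by rewrite div0n !big_geq.
rewrite big_nat_recr //= IH divnS //; case: (boolP (d %| x.+1)) => dx /=.
  have E : (x %/ d).+1 = x.+1 %/ d by rewrite divnS // dx add1n.
  rewrite add1n (@big_nat_recr _ _ _ (x %/ d).+1) //= E mulnC; congr (_ + _).
  by rewrite (mulnC d) divnK // muln1.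
by rewrite mul0n addn0 add0n.
Qed.

(** Pairs (n, p) with p | n are grouped by p instead of n. *)
Lemma double_count (P : pred nat) (w F : nat -> nat) T x :
  (forall p, P p -> 0 < p) ->
  \sum_(1 <= n < x.+1) F n * (\sum_(0 <= p < T | P p && (p %| n)) w p) =
  \sum_(0 <= p < T | P p) w p * \sum_(1 <= m < (x %/ p).+1) F (p * m).
Proof.
move=> P0.
transitivity (\sum_(1 <= n < x.+1) \sum_(0 <= p < T | P p) (p %| n) * (w p * F n)).
  apply: eq_bigr => n _; rewrite big_mkcondr big_distrr /=.
  by apply: eq_bigr => p _; case: (p %| n); rewrite ?mul1n ?mul0n ?muln0 // mulnC.
rewrite exchange_big /=; apply: eq_bigr => p /P0 p0.
by rewrite (sum_multiples _ (fun n => w p * F n)) // big_distrr.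
Qed.

Lemma double_count_sieved z y (P : pred nat) (w : nat -> nat) T x :
  (forall p, P p -> prime_in z y p) ->
  \sum_(1 <= n < x.+1) sieved z y n * (\sum_(0 <= p < T | P p && (p %| n)) w p) =
  \sum_(0 <= p < T | P p) w p * count_sieved z y (x %/ p).
Proof.
move=> Pz; rewrite double_count => [|p /Pz /andP[/prime_gt0]] //.
apply: eq_bigr => p /Pz pz; congr (_ * _).
by apply: eq_bigr => m _; rewrite sievedM sieved_prime.
Qed.

Lemma sum_lg_dvd_sub (P : pred nat) T n : 0 < n -> (forall p, P p -> prime p) ->
  \sum_(0 <= p < T | P p && (p %| n)) lg p <= lg n.
Proof.
move=> n0 Pp; apply: leq_trans (sum_lg_dvd T n0).
by apply: leq_sum_pred => p /andP[/Pp -> ->].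
Qed.

Lemma omega_le (P : pred nat) T n : 0 < n -> (forall p, P p -> prime p) ->
  \sum_(0 <= p < T | P p && (p %| n)) 1 <= lg n.
Proof.
move=> n0 Pp; apply: leq_trans (sum_lg_dvd_sub T n0 Pp).
by apply: leq_sum => p /andP[/Pp /lg_prime_gt0].
Qed.

(** Multiplying a number up to x / t by a prime up to t gives a number up to
    x, and each of these is reached at most lg x times. *)
Lemma count_sieved_div z y x t : t <= y ->
  count_sieved z y (x %/ t) * (\sum_(0 <= p < t.+1 | prime p && (z < p)) 1) <=
  lg x * count_sieved z y x.
Proof.
move=> ty.
pose P := [pred p | prime_in z y p && (p <= t)].
apply: (@leq_trans (\sum_(0 <= p < t.+1 | P p) 1 * count_sieved z y (x %/ p))).
  rewrite mulnC big_distrl /= big_nat_cond [leqRHS]big_nat_cond.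
  rewrite (eq_bigl (fun p => (0 <= p < t.+1) && P p)).
    apply: leq_sum => p /andP[/andP[_ pt] /andP[/andP[pp /andP[zp _]] _]].
    rewrite !mul1n count_sieved_mono // leq_div2l //.
    exact: prime_gt0.
  move=> p; rewrite /P /= /prime_in; case: (ltnP p t.+1) => // pt.
  have pt' : p <= t := pt.
  by rewrite pt' (leq_trans pt' ty) !andbT.
rewrite -double_count_sieved; last by move=> p /andP[].
rewrite /count_sieved big_distrr /= big_nat_cond [leqRHS]big_nat_cond.
apply: leq_sum => n /andP[/andP[n0 nx] _].
rewrite mulnC leq_mul2r; case: (sieved _ _ _) => //=.
apply: leq_trans (leq_trunc_log 2 (_ : n <= x)) => //.
by apply: omega_le => // p /andP[/andP[]].
Qed.

Lemma count_sieved_div_weak z : exists r0, forall y x t, r0 <= t -> t <= y ->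
  t * count_sieved z y (x %/ t) <= 10 * lg y * lg x * count_sieved z y x.
Proof.
have [r0 H] := nprimes_gt_lower z; exists r0 => y x t rt ty.
apply: (@leq_trans (10 * lg t * (lg x * count_sieved z y x))).
  apply: (leq_trans (leq_mul (H _ rt) (leqnn _))).
  by rewrite -!mulnA [_ * count_sieved _ _ _]mulnC !leq_mul2l count_sieved_div ?orbT.
by rewrite -!mulnA !leq_mul2l leq_mul2r leq_trunc_log ?orbT.
Qed.

(** * Exchanging large prime factors *)

Definition harmonic (R : realFieldType) (P : pred nat) (y : nat) : R :=
  (\sum_(0 <= p < y.+1 | P p) p%:R^-1)%R.

Lemma harmonic_ge0 (R : realFieldType) P y : (0 <= harmonic R P y)%R.
Proof. by apply: sumr_ge0 => p _; rewrite invr_ge0 ler0n. Qed.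

(** The gain of an exchange, iterated: t N(x / t) is bounded for a t which is
    roughly a product of i primes near y.  Each step divides t by a prime of the window
    P, which lies a little below y, and averages over P.  Relative to y^i the number t
    grows by a factor between s / 2 and s^2 at each step, so when i reaches 0 it lies
    between r0 and y, where [hbase] applies.  The factor 2 per step
    pays for rounding t / p down. *)
Lemma count_sieved_swap (R : realFieldType) z y s q g x0 j B r0 (P : pred nat) :
  (forall p, P p -> [/\ prime_in z y p, y < p * s ^ 2 & p * s <= y]) ->
  s ^ (2 * g) <= y -> 0 < r0 -> 0 < q -> r0 * (2 * q) ^ g <= s ^ g ->
  (forall x t, r0 <= t -> t <= y -> x <= x0 ->
     t * count_sieved z y (x %/ t) <= B * count_sieved z y x) ->
  (forall n, 0 < n -> n <= x0 -> \sum_(0 <= p < y.+1 | P p && (p %| n)) 1 <= j) ->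
  forall i k x t, i + k = g -> x <= x0 -> t <= y ^ i * s ^ (2 * k) ->
    y ^ i * s ^ k <= t * q ^ g * 2 ^ k ->
  ((t * count_sieved z y (x %/ t))%:R * harmonic R P y ^+ i <=
   ((2 * j) ^ i * (B * count_sieved z y x))%:R)%R.
Proof.
move=> hP hs r0_gt0 q0 hr hbase hj.
elim=> [|i IH] k x t ikg xx0 tle tge.
  rewrite expr0 mulr1 expn0 mul1n ler_nat; apply: hbase => //.
    rewrite add0n in ikg; rewrite -ikg expn0 mul1n in hr tge.
    have qk : 0 < (2 * q) ^ k by rewrite expn_gt0 muln_gt0 q0.
    rewrite -(leq_pmul2r qk); apply: (leq_trans hr); apply: (leq_trans tge).
    by rewrite expnMn (mulnC (2 ^ k)) mulnA.
  apply: leq_trans tle _; rewrite expn0 mul1n; move: ikg; rewrite add0n => -> //.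
have g0 : 0 < g by rewrite -ikg.
have s0 : 0 < s.
  have : 0 < r0 * (2 * q) ^ g by rewrite muln_gt0 r0_gt0 expn_gt0 muln_gt0 q0.
  by move=> /leq_trans /(_ hr); rewrite expn_gt0 (gtn_eqF g0) orbF.
have y0 : 0 < y by apply: leq_trans hs; rewrite expn_gt0 s0.
have sy : s <= y.
  apply: leq_trans hs; rewrite -{1}(expn1 s) leq_pexp2l //; lia.
have step p : P p ->
    ((t * count_sieved z y (x %/ t))%:R * harmonic R P y ^+ i * p%:R^-1 <=
     (2 * ((2 * j) ^ i * (B * count_sieved z y (x %/ p))))%:R)%R.
  move=> Pp; have [/andP[pp /andP[zp py]] yps psy] := hP _ Pp.
  have p0 := prime_gt0 pp.
  have pt : p <= t.
    have q1 : 0 < q ^ g * 2 ^ k by rewrite muln_gt0 !expn_gt0 q0.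
    rewrite -(leq_pmul2r q1) mulnA.
    apply: leq_trans (_ : y ^ i.+1 * s ^ k <= _); last by rewrite mulnA.
    rewrite -(leq_pmul2l s0).
    apply: (@leq_trans (y * s ^ g)).
      have h1 : q ^ g * 2 ^ k <= s ^ g.
        apply: (@leq_trans ((2 * q) ^ g)); last by apply: leq_trans hr; rewrite leq_pmull.
        rewrite expnMn mulnC leq_mul2r leq_exp2l //; apply/orP; right; lia.
      apply: leq_trans (leq_mul psy h1).
      by apply/eq_leq; ring.
    have -> : s * (y ^ i.+1 * s ^ k) = y * (y ^ i * s ^ k.+1) by rewrite !expnS; ring.
    rewrite leq_mul2l; apply/orP; right.
    have -> : g = i + k.+1 by lia.
    rewrite expnD leq_mul //.
    by case: (i) => // i'; rewrite leq_exp2r.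
  set t' := t %/ p.
  have t'p : t' * p <= t by rewrite leq_trunc_div.
  have t'p2 : t < t'.+1 * p by rewrite ltn_ceil.
  have t'0 : 0 < t' by rewrite divn_gt0.
  have t2 : t <= t' * p * 2 by apply: leq_trans (ltnW t'p2) _; nia.
  have up : t' <= y ^ i * s ^ (2 * k.+1).
    rewrite -(leq_pmul2r y0).
    apply: (@leq_trans (t * s ^ 2)).
      apply: (@leq_trans (t' * p * s ^ 2)); first by rewrite -mulnA leq_mul2l ltnW ?orbT.
      by rewrite leq_mul2r t'p orbT.
    apply: (@leq_trans (y ^ i.+1 * s ^ (2 * k) * s ^ 2)).
      by rewrite leq_mul2r tle orbT.
    by rewrite -mulnA -expnD expnSr mulnAC mulnS addnC.
  have lo : y ^ i * s ^ k.+1 <= t' * q ^ g * 2 ^ k.+1.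
    rewrite -(leq_pmul2r y0).
    apply: (@leq_trans (t * q ^ g * 2 ^ k * s)).
      apply: (@leq_trans (y ^ i.+1 * s ^ k * s)).
        by rewrite !expnSr; apply/eq_leq; ring.
      by rewrite leq_mul2r tge orbT.
    apply: (@leq_trans (t' * p * 2 * q ^ g * 2 ^ k * s)).
      by rewrite !leq_mul2r t2 !orbT.
    apply: (@leq_trans (t' * q ^ g * 2 ^ k.+1 * (p * s))).
      by rewrite expnSr; apply/eq_leq; ring.
    by rewrite leq_mul2l psy orbT.
  have := IH k.+1 (x %/ p) t' _ _ up lo.
  rewrite addnS => /(_ ikg (leq_trans (leq_div x p) xx0)) IHt.
  rewrite ler_pdivrMr ?ltr0n //.
  apply: (@le_trans _ _ ((2 * p)%:R * ((t' * count_sieved z y (x %/ p %/ t'))%:R * harmonic R P y ^+ i))%R).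
    rewrite mulrA -natrM ler_wpM2r ?exprn_ge0 ?harmonic_ge0 // ler_nat mulnA.
    apply: leq_mul; first by apply: leq_trans t2 _; apply/eq_leq; ring.
    apply: count_sieved_mono; rewrite -divnMA leq_div2l ?muln_gt0 ?p0 //.
    by rewrite mulnC.
  rewrite -natrM.
  have -> : (2 * ((2 * j) ^ i * (B * count_sieved z y (x %/ p))) * p =
     (2 * p) * ((2 * j) ^ i * (B * count_sieved z y (x %/ p)))) by ring.
  by rewrite [leRHS]natrM ler_wpM2l.
have big : (\sum_(0 <= p < y.+1 | P p)
    ((t * count_sieved z y (x %/ t))%:R * harmonic R P y ^+ i * p%:R^-1) <=
    \sum_(0 <= p < y.+1 | P p)
     (2 * ((2 * j) ^ i * (B * count_sieved z y (x %/ p))))%:R :> R)%R.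
  by apply: ler_sum => p; apply: step.
rewrite exprSr mulrA {2}/harmonic mulr_sumr (le_trans big) // -natr_sum ler_nat.
apply: (@leq_trans ((2 * ((2 * j) ^ i * B)) *
    \sum_(0 <= p < y.+1 | P p) 1 * count_sieved z y (x %/ p))).
  by rewrite big_distrr /=; apply/eq_leq/eq_bigr => p _; ring.
rewrite -double_count_sieved; last by move=> p /hP[].
have -> : (2 * j) ^ i.+1 * (B * count_sieved z y x) =
  (2 * ((2 * j) ^ i * B)) * (j * count_sieved z y x) by rewrite expnS; ring.
rewrite leq_mul2l; apply/orP; right.
rewrite /count_sieved big_distrr /= big_nat_cond [leqRHS]big_nat_cond.
apply: leq_sum => n /andP[/andP[n0 nx] _].
rewrite mulnC leq_mul2r hj ?orbT //; lia.
Qed.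

Definition omega (P : pred nat) y n := \sum_(0 <= p < y.+1 | P p && (p %| n)) 1.

(** The numbers with at least k prime factors in P; to be applied to the primes in
    (y / Q, y], of which a typical number has few. *)
Definition count_rich z y P k x :=
  \sum_(1 <= n < x.+1) (sieved z y n && (k <= omega P y n)).

Lemma omega_prime_mul (P : pred nat) y p m : (forall r, P r -> prime r) ->
  prime p -> omega P y (p * m) <= (omega P y m).+1.
Proof.
move=> Pp pp; rewrite /omega.
apply: (@leq_trans (\sum_(0 <= r < y.+1 | P r && (r %| m)) 1 + \sum_(0 <= r < y.+1 | r == p) 1)).
  rewrite big_mkcond [X in _ <= X + _]big_mkcond [X in _ <= _ + X]big_mkcond -big_split /=.
  apply: leq_sum => r _; case: (boolP (P r)) => //= /Pp pr.
  rewrite Euclid_dvdM // dvdn_prime2 //.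
  by case: (r == p); case: (r %| m).
rewrite -[leqRHS]addn1 leq_add2l sum1_count.
by rewrite (count_uniq_mem _ (iota_uniq _ _)) leq_b1.
Qed.

(** A number with k + 1 prime factors in P is p * m in at least k + 1 ways,
    where m has at least k of them. *)
Lemma count_rich_rec z y (P : pred nat) k x :
  (forall p, P p -> prime_in z y p) ->
  k.+1 * count_rich z y P k.+1 x <=
  \sum_(0 <= p < y.+1 | P p) count_rich z y P k (x %/ p).
Proof.
move=> Pz; have Pp p : P p -> prime p by move=> /Pz /andP[].
apply: (@leq_trans (\sum_(1 <= n < x.+1)
   (sieved z y n && (k.+1 <= omega P y n)) * (\sum_(0 <= p < y.+1 | P p && (p %| n)) 1))).
  rewrite /count_rich big_distrr /=; apply: leq_sum => n _.
  rewrite mulnC; case: (sieved z y n) => //=; case: leqP => //= h.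
  by rewrite !mul1n.
rewrite double_count; last by move=> p /Pp /prime_gt0.
apply: leq_sum => p Pp'; rewrite mul1n; apply: leq_sum => m _.
rewrite sievedM; case: (sieved z y m); rewrite ?andbF // andbT.
case: (sieved z y p) => //=.
have := omega_prime_mul y m Pp (Pp _ Pp').
case: (ltnP k (omega P y (p * m))) => //= h1 h2.
by have -> : k <= omega P y m by exact: leq_trans h1 h2.
Qed.

(** Removing g primes one after the other reduces the count to values
    N(x0 / t) where t is a product of g primes near y, so that the weights 1 / t add up
    to a power of the harmonic sum over P.  The lower bound c for the number of prime
    factors still present is uniform over the g steps. *)
Lemma count_rich_le (R : realFieldType) z y Q g x0 c (A : R) (P : pred nat) :
  (forall p, P p -> prime_in z y p /\ y < p * Q) ->
  (forall t, y ^ g <= t * Q ^ g -> t <= y ^ g ->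
     ((t * count_sieved z y (x0 %/ t))%:R <= A)%R) ->
  forall i j k t, i + j = g -> c + i <= k -> y ^ j <= t * Q ^ j -> t <= y ^ j ->
  ((t * c ^ i * count_rich z y P k (x0 %/ t))%:R <= harmonic R P y ^+ i * A)%R.
Proof.
move=> Pz hA; elim=> [|i IH] j k t ijg cik t1 t2.
  rewrite expr0 mul1r expn0 muln1; apply: le_trans (hA t _ _); rewrite -?ijg //.
  rewrite ler_nat leq_mul2l; apply/orP; right; apply: leq_sum => n _.
  by case: (sieved _ _ _) => //=; exact: leq_b1.
case: k cik => [|k cik]; first by rewrite addnS.
have Pz' p : P p -> prime_in z y p by move=> /Pz[].
apply: (@le_trans _ _ (\sum_(0 <= p < y.+1 | P p)
   (t * c ^ i * count_rich z y P k ((x0 %/ t) %/ p))%:R)%R).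
  rewrite -natr_sum ler_nat -big_distrr /=.
  apply: leq_trans (leq_mul (leqnn _) (count_rich_rec k (x0 %/ t) Pz')).
  rewrite expnSr !mulnA -!(mulnA (t * c ^ i)) !leq_mul2l leq_mul2r.
  by apply/orP; right; apply/orP; right; lia.
rewrite exprSr -mulrA mulrC -mulrA mulr_suml; apply: ler_sum => p Pp.
have [/andP[pp /andP[_ py]] ypQ] := Pz _ Pp.
have p0 := prime_gt0 pp.
have : ((t * p * c ^ i * count_rich z y P k (x0 %/ (t * p)))%:R <= harmonic R P y ^+ i * A)%R.
  apply: (IH j.+1); first by lia.
  - lia.
  - have -> : t * p * Q ^ j.+1 = (p * Q) * (t * Q ^ j) by rewrite expnS; ring.
    by rewrite expnS leq_mul // ltnW.
  - by rewrite expnSr leq_mul.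
rewrite mulrC mulrC [(A * _)%R]mulrC ler_pdivlMl ?ltr0n //.
move=> h; apply: le_trans h; rewrite -natrM ler_nat divnMA.
by apply/eq_leq; ring.
Qed.

(** * Harmonic sums over primes *)

(** Splits a harmonic sum according to the scale f p of the prime p. *)
Lemma harmonic_fibres (R : realFieldType) (P : pred nat) (f : nat -> nat) y m n :
  (\sum_(m <= i < n) harmonic R [pred p | P p && (f p == i)] y =
   harmonic R [pred p | P p && (m <= f p < n)%N] y)%R.
Proof.
rewrite /harmonic.
under eq_bigr do rewrite big_mkcond.
rewrite exchange_big [RHS]big_mkcond /=; apply: eq_bigr => p _.
case: (P p) => /=; last by rewrite big1.
rewrite -big_mkcond /= (eq_bigl (fun i => i == f p)) => [|i]; last exact: eq_sym.
by rewrite big_nat1_eq.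
Qed.

Lemma harmonic_sub (R : realFieldType) (P Q : pred nat) y :
  (forall p, p <= y -> P p -> Q p) -> (harmonic R P y <= harmonic R Q y)%R.
Proof.
move=> PQ; rewrite /harmonic big_nat_cond [leRHS]big_nat_cond.
rewrite big_mkcond [leRHS]big_mkcond /=; apply: ler_sum => p _.
case: (ltnP p y.+1) => //= py; case: ifP => [/(PQ _ py) ->//|_].
by case: ifP; rewrite ?invr_ge0.
Qed.

Lemma trunc_log_div b y p i : 1 < b -> 0 < p -> p <= y ->
  (trunc_log b (y %/ p) == i) = (y < p * b ^ i.+1) && (p * b ^ i <= y).
Proof.
move=> b1 p0 py; have q0 : 0 < y %/ p by rewrite divn_gt0.
apply/eqP/andP => [<-|[h1 h2]].
  have /andP[l1 l2] := trunc_log_bounds b1 q0.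
  by split; [rewrite mulnC -ltn_divLR | rewrite mulnC -leq_divRL].
apply: trunc_log_eq => //.
by rewrite leq_divRL // ltn_divLR // ![_ * p]mulnC h1 h2.
Qed.

(** By Chebyshev each of the lg Q dyadic scales between y / Q and y
    contributes O(1 / log y). *)
Lemma harmonic_top_le (R : realFieldType) z y Q : 0 < Q -> 2 * (lg Q).+1 <= lg y ->
  ((lg y)%:R * harmonic R [pred p | prime_in z y p && (y < p * Q)%N] y <= 48 * (lg Q).+1%:R)%R.
Proof.
move=> Q0 Qy; have ly0 : 0 < lg y by lia.
have y0 : 0 < y by case: (y) ly0; rewrite ?trunc_log0.
set P := [pred p | _].
have : (harmonic R P y <= \sum_(0 <= i < (lg Q).+1) harmonic R [pred p | P p && (lg (y %/ p) == i)] y)%R.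
  rewrite harmonic_fibres; apply: harmonic_sub => p py Pp.
  apply/andP; split=> //; rewrite ltnS; apply: leq_trunc_log.
  case/andP: Pp => /andP[pp _] yQ; apply: ltnW.
  by rewrite ltn_divLR ?prime_gt0 // mulnC.
move=> h; apply: (@le_trans _ _ ((lg y)%:R * \sum_(0 <= i < (lg Q).+1) harmonic R [pred p | P p && (lg (y %/ p) == i)] y)%R).
  by rewrite ler_wpM2l.
rewrite mulr_sumr; apply: (@le_trans _ _ (\sum_(0 <= i < (lg Q).+1) 48)%R); last first.
  by rewrite big_const_nat subn0 iter_addr addr0 mulr_natr.
rewrite big_nat_cond [leRHS]big_nat_cond; apply: ler_sum => i /andP[/andP[_ iQ] _].
set v := y %/ 2 ^ i.
have v1 : lg y <= 2 * lg v.
  have : lg y - i <= lg v.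
    apply: trunc_log_max => //; rewrite leq_divRL ?expn_gt0 // -expnD subnK ?lg_le //; lia.
  lia.
have vy : v * 2 ^ i <= y by rewrite leq_trunc_div.
have cnt : lg y * nprimes v <= 24 * v.
  have := nprimes_upper v; nia.
apply: (@le_trans _ _ ((lg y)%:R * ((nprimes v)%:R * (2 ^ i.+1)%:R / y%:R))%R); last first.
  rewrite !mulrA ler_pdivrMr ?ltr0n // -!natrM ler_nat.
  have : lg y * nprimes v * 2 ^ i.+1 <= 24 * v * 2 ^ i.+1 by rewrite leq_mul2r cnt orbT.
  rewrite expnS; lia.
rewrite ler_wpM2l // /harmonic.
apply: (@le_trans _ _ (\sum_(0 <= p < y.+1 | P p && (lg (y %/ p) == i)) ((2 ^ i.+1)%:R / y%:R))%R).
  rewrite big_nat_cond [leRHS]big_nat_cond; apply: ler_sum => p.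
  case/andP=> /andP[_ py] /andP[/andP[/andP[pp _] _]]; have p0 := prime_gt0 pp.
  rewrite trunc_log_div // => /andP[h1 _].
  rewrite ler_pdivlMr ?ltr0n // mulrC ler_pdivrMr ?ltr0n // -natrM ler_nat mulnC.
  exact: ltnW.
rewrite big_const_seq iter_addr_0 -[leRHS]mulrA -[leLHS]mulr_natl.
rewrite ler_wpM2r ?divr_ge0 // ler_nat.
apply: count_prime_le => p /andP[Pp].
have [py|py] := leqP p y; last first.
  by rewrite divn_small // trunc_log0 => /eqP i0; case/andP: Pp => /andP[_ /andP[_]]; rewrite leqNgt py.
case/andP: Pp => /andP[pp _] _; have p0 := prime_gt0 pp.
by rewrite trunc_log_div // => /andP[_ pv]; rewrite pp /= leq_divRL ?expn_gt0.
Qed.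

(** By Chebyshev each of the a scales of ratio 256 between y / s^2 and y / s,
    where s = 256^a, contributes at least a constant times 1 / log y. *)
Lemma harmonic_window_ge (R : realFieldType) z y a : 0 < a -> z <= a -> 32 * a <= lg y ->
  (a%:R <= 256 * (lg y)%:R * harmonic R
     [pred p | prime_in z y p && ((y < p * (256 ^ a) ^ 2) && (p * 256 ^ a <= y))%N] y)%R.
Proof.
move=> a0 za ay; have ly0 : 0 < lg y by lia.
have y0 : 0 < y by case: (y) ly0; rewrite ?trunc_log0.
have e256 n : 256 ^ n = 2 ^ (8 * n) by rewrite expnM.
set P := [pred p | _].
have : (\sum_(a <= i < a.*2) harmonic R [pred p | P p && (trunc_log 256 (y %/ p) == i)] y <= harmonic R P y)%R.
  by rewrite harmonic_fibres; apply: harmonic_sub => p _ /andP[].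
move=> h; apply: (@le_trans _ _ (256 * (lg y)%:R * \sum_(a <= i < a.*2) harmonic R [pred p | P p && (trunc_log 256 (y %/ p) == i)] y)%R); last first.
  by rewrite ler_wpM2l // mulr_ge0.
rewrite mulr_sumr; apply: (@le_trans _ _ (\sum_(a <= i < a.*2) 1)%R).
  by rewrite big_const_nat iter_addr_0 -addnn addnK.
rewrite big_nat_cond [leRHS]big_nat_cond; apply: ler_sum => i /andP[/andP[ai ia] _].
set u := y %/ 256 ^ i.+1.
have lu : 16 * a <= lg u.
  apply: trunc_log_max => //; rewrite leq_divRL ?expn_gt0 // e256 -expnD.
  apply: leq_trans (lg_le y0); rewrite leq_exp2l //; lia.
have u0 : 0 < u by case: (u) lu; rewrite ?trunc_log0 //; lia.
have uy : u <= y by apply: leq_div.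
have zu : z <= u by have := ltn_lg u0; lia.
have luy : lg u <= lg y by apply: leq_trunc_log.
have := nprimes_interval (_ : 8 <= lg u); move=> /(_ ltac:(lia)).
set C := \sum_(_ <= _ < _ | _) 1 => hC.
have u256 : 256 * u * 256 ^ i <= y.
  by rewrite (mulnC 256) -mulnA -expnS leq_trunc_div.
have sub p : (0 <= p < (256 * u).+1) && (prime p && (u < p)) ->
    (0 <= p < y.+1) && (P p && (trunc_log 256 (y %/ p) == i)).
  rewrite ltnS => /andP[/andP[_ pu] /andP[pp up]]; have p0 := prime_gt0 pp.
  have pi : p * 256 ^ i <= y by apply: leq_trans u256; rewrite leq_mul2r pu orbT.
  have py : p <= y by apply: leq_trans pi; rewrite leq_pmulr ?expn_gt0.
  have yp : y < p * 256 ^ i.+1 by rewrite -ltn_divLR ?expn_gt0.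
  have zp : z < p by apply: leq_ltn_trans up.
  rewrite /= trunc_log_div // yp pi /prime_in pp py zp ltnS py !andbT /=.
  apply/andP; split.
    apply: leq_trans yp _; rewrite leq_mul2l -expnM leq_exp2l //.
    by apply/orP; right; lia.
  by apply: leq_trans pi; rewrite leq_mul2l leq_exp2l // ai orbT.
apply: (@le_trans _ _ (256 * (lg y)%:R * (C%:R / (256 * u)%:R))%R).
  rewrite mulrA ler_pdivlMr ?ltr0n ?muln_gt0 ?u0 // mul1r natrM -mulrA ler_wpM2l //.
  rewrite -natrM ler_nat; apply: leq_trans hC _; by rewrite leq_mul2r luy orbT.
rewrite ler_wpM2l ?mulr_ge0 // /C natr_sum mulr_suml /harmonic.
have uy' : (256 * u).+1 <= y.+1.
  by rewrite ltnS; apply: leq_trans u256; rewrite leq_pmulr ?expn_gt0.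
rewrite (big_nat_widen _ _ _ _ _ uy') big_mkcond [leRHS]big_mkcond /=.
apply: ler_sum => p _.
case: ifP => [/andP[/andP[pp up] pu]|_]; last by case: ifP; rewrite ?invr_ge0.
have /andP[_ ->] : (0 <= p < y.+1) && (P p && (trunc_log 256 (y %/ p) == i)).
  by apply: sub; rewrite pu pp.
have p0 : (0 < p%:R :> R)%R by rewrite ltr0n prime_gt0.
have q0 : (0 < (256 * u)%:R :> R)%R by rewrite ltr0n muln_gt0 u0.
by rewrite mul1r lef_pV2 // ler_nat -ltnS.
Qed.

(** * Numbers with many prime factors close to y *)

(** A product of prime divisors of n each at least sqrt y is at most n. *)
Lemma omega_large (P : pred nat) y n : 0 < n ->
  (forall p, P p -> prime p /\ y <= p ^ 2) ->
  omega P y n * lg y <= 2 * lg n + 1.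
Proof.
move=> n0 Py; have [->|y0] := posnP y; first by rewrite trunc_log0 muln0.
have h : 2 ^ (omega P y n * lg y) <= n ^ 2.
  apply: (@leq_trans ((\prod_(0 <= p < y.+1 | P p && (p %| n)) p) ^ 2)); last first.
    rewrite leq_exp2r //; apply: leq_trans (dvdn_leq n0 (prod_prime_dvd y.+1 n)).
    rewrite big_mkcond [leqRHS]big_mkcond /=; apply: leq_prod => p _.
    case: ifP => [/andP[/Py[-> _] ->] //|_].
    by case: ifP => // /andP[/prime_gt0].
  rewrite /omega; apply: (big_ind2 (fun a b => 2 ^ (a * lg y) <= b ^ 2)) => //.
    by move=> a b c d h1 h2; rewrite mulnDl expnD expnMn leq_mul.
  move=> p /andP[/Py[_ yp] _]; rewrite mul1n; apply: leq_trans yp.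
  exact: lg_le.
have : omega P y n * lg y <= lg (n ^ 2) by apply: trunc_log_max.
have := lgM_leq n n; rewrite -mulnn; lia.
Qed.

(** The last inequality says that an exchange of g primes gains more than the
    loss, which is of order lg x * lg y; H stands for the loss at each step.  There are
    two regimes.  If L <= (lg y)^2 the loss is polylogarithmic in y, and four steps with
    a window s = 256^a equal to a small power of y suffice.  Otherwise a is a constant
    larger than 2 H, each step gains a factor 2, and g of order lg y steps gain a power
    of y, which exceeds the loss because L^K <= y. *)
Lemma exchange_parameters z r0 Q H : exists K y0, forall y L,
  y0 <= y -> L ^ K <= y -> 128 * lg y <= L ->
  exists g a, [/\ 0 < g, g <= L %/ lg y %/ 32 & 0 < a] /\
    [/\ z <= a, 32 * a <= lg y, (256 ^ a) ^ (2 * g) <= y,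
        r0 * (2 * Q) ^ g <= (256 ^ a) ^ g & 80 * lg y * L * H ^ g <= a ^ g].
Proof.
(* A serves as the constant window of the second regime, and as a lower bound for
   the window in the first one. *)
pose A := (z + r0 * (2 * Q) + 2 * H).+2.
have [y1 Hy1] := lg_dominated (32 * A * 2) (80 ^ (32 * A * 2)).
pose l0 := 128 * A + 80 * 128 ^ 4 * H ^ 4.
have e256 n : 256 ^ n = 2 ^ (8 * n) by rewrite expnM.
have win b g : A <= b -> 0 < g -> r0 * (2 * Q) ^ g <= (256 ^ b) ^ g.
  move=> Ab g0; apply: (@leq_trans ((r0 * (2 * Q)) ^ g)).
    rewrite [leqRHS]expnMn leq_mul2r; apply/orP; right.
    by case: (r0) => // r; rewrite -{1}(expn1 r.+1) leq_pexp2l.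
  rewrite leq_exp2r //; apply: leq_trans (ltnW (ltn_expl b (isT : 1 < 256))).
  by apply: leq_trans Ab; rewrite /A; lia.
exists (64 * A), (y1 + 2 ^ l0) => y L yy LK uL.
have y0 : 0 < y by apply: leq_trans yy; rewrite addn_gt0 expn_gt0 orbT.
have ly : l0 <= lg y by apply: trunc_log_max => //; apply: leq_trans yy; rewrite leq_addl.
have ly0 : 0 < lg y by rewrite /l0 /A in ly; lia.
have wy b g : 16 * b * g <= lg y -> (256 ^ b) ^ (2 * g) <= y.
  move=> h; rewrite -expnM e256; apply: leq_trans (lg_le y0).
  by rewrite leq_exp2l //; lia.
have [Lle|Lgt] := leqP L (lg y ^ 2).
  (* 256^(2 * 4 * a) <= y as 64 a <= lg y. *)
  exists 4, (lg y %/ 64).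
  have a1 : A <= lg y %/ 64 by rewrite leq_divRL //; rewrite /l0 in ly; lia.
  have a2 : lg y %/ 64 * 64 <= lg y by rewrite leq_trunc_div.
  have a3 : lg y <= (lg y %/ 64) * 128.
    have := ltn_ceil (lg y) (isT : 0 < 64); rewrite /A in a1; lia.
  split; split=> //.
  - rewrite !leq_divRL //; lia.
  - by rewrite /A in a1; lia.
  - by rewrite /A in a1; lia.
  - lia.
  - by apply: wy; lia.
  - exact: win.
  - set l := lg y in ly Lle a3 *; set a := l %/ 64 in a3 *.
    have h1 : l ^ 4 <= a ^ 4 * 128 ^ 4 by rewrite -expnMn leq_exp2r.
    rewrite -(leq_pmul2r (_ : 0 < 128 ^ 4)); last by rewrite expn_gt0.
    apply: leq_trans h1.
    apply: (@leq_trans (80 * l * l ^ 2 * H ^ 4 * 128 ^ 4)).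
      by rewrite !leq_mul2r leq_mul2l Lle !orbT.
    have -> : 80 * l * l ^ 2 * H ^ 4 * 128 ^ 4 = (80 * 128 ^ 4 * H ^ 4) * l ^ 3.
      move: (128 ^ 4) => e; ring.
    rewrite (expnS l 3) leq_mul2r; apply/orP; right.
    by apply: leq_trans ly; rewrite /l0 leq_addl.
(* g is the largest number with (256^A)^(2 g) <= 2^(lg y). *)
exists (lg y %/ (16 * A)), A.
have A0 : 0 < A by [].
set g := lg y %/ (16 * A).
have g0 : 0 < g by rewrite divn_gt0 ?muln_gt0 //; rewrite /l0 in ly; lia.
have g1 : g * (16 * A) <= lg y by rewrite leq_trunc_div.
have g2 : lg y < g.+1 * (16 * A) by rewrite ltn_ceil // muln_gt0.
split; split=> //.
- rewrite leq_divRL // leq_divRL //.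
  apply: (@leq_trans (lg y * lg y)); last by rewrite mulnn ltnW.
  rewrite leq_mul2r; apply/orP; right; apply: leq_trans g1.
  by rewrite leq_mul2l /A; apply/orP; right; lia.
- by rewrite /A; lia.
- by rewrite /l0 in ly; lia.
- by apply: wy; lia.
- exact: win.
apply: (@leq_trans (2 ^ g * H ^ g)); last first.
  by rewrite -expnMn leq_exp2r //; rewrite /A; lia.
rewrite leq_mul2r; apply/orP; right.
apply: ltnW; rewrite -(ltn_exp2r _ _ (_ : 0 < 32 * A)) ?muln_gt0 //.
apply: (@leq_trans (2 ^ (lg y).+1)); last first.
  by rewrite -expnM leq_exp2l //; nia.
apply: leq_trans (lg_gt y).
rewrite ltnS -(leq_exp2r _ _ (isT : 0 < 2)) -expnM expnMn expnMn.
rewrite -[y ^ 2]mulnn leq_mul //.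
  by rewrite Hy1 //; lia.
by apply: leq_trans LK; rewrite leq_eqVlt; apply/orP; left; apply/eqP; congr (_ ^ _); lia.
Qed.

(** Combines the two halves of the exchange.  Numbers up to x have at most
    6 u prime factors in the window, where u is about log x / log y, and rich ones keep
    at least u / 64 prime factors near y during g <= u / 32 removals; so these numbers of
    choices cancel up to a constant per step, and the ratio of the two harmonic sums
    decides. *)
Lemma rich_rare_over (R : realFieldType) z Q : 0 < Q -> exists K y0, forall y x,
  y0 <= y -> lg x ^ K <= y -> 128 * lg y <= lg x -> forall x', x' <= x ->
  8 * count_rich z y [pred p | prime_in z y p && (y < p * Q)]
        (lg x %/ lg y %/ 8) x' <= count_sieved z y x'.
Proof.
move=> Q0; have [r0 Hr0] := count_sieved_div_weak z.
pose h := 48 * (lg Q).+1; pose H := 512 * 6 * 64 * h.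
have [K [y1 Hpar]] := exchange_parameters z r0.+1 Q H.
exists K, (y1 + 2 ^ (2 * (lg Q).+1)) => y x yy LK uL x' x'x.
have y0 : 0 < y by apply: leq_trans yy; rewrite addn_gt0 expn_gt0 orbT.
have Qy : 2 * (lg Q).+1 <= lg y by apply: trunc_log_max => //; apply: leq_trans yy; rewrite leq_addl.
have ly0 : 0 < lg y by lia.
have [g [a [[g0 gu a0] [za ay say rs par]]]] := Hpar y (lg x) (leq_trans (leq_addr _ _) yy) LK uL.
set u := lg x %/ lg y in gu *; set c := u %/ 32 in gu.
have u128 : 128 <= u by rewrite leq_divRL.
have uc : u <= 64 * c by have := ltn_ceil u (isT : 0 < 32); rewrite -/c; lia.
have c0 : 0 < c by lia.
have lu : lg x < u.+1 * lg y by rewrite ltn_ceil.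
set P := [pred p | _].
pose W := [pred p | prime_in z y p && ((y < p * (256 ^ a) ^ 2) && (p * 256 ^ a <= y))].
set B := 10 * lg y * lg x.
have s4 : (256 ^ a) ^ 4 <= y.
  rewrite -expnM (_ : 256 ^ _ = 2 ^ (8 * (a * 4))); last by rewrite [RHS]expnM.
  by apply: leq_trans (lg_le y0); rewrite leq_exp2l //; lia.
have hj n : 0 < n -> n <= x -> \sum_(0 <= p < y.+1 | W p && (p %| n)) 1 <= 6 * u.
  move=> n0 nx; have := @omega_large W y n n0 _; rewrite /omega.
  set o := \sum_(_ <= _ < _ | _) _ => /(_ _)/wrap[].
    move=> p /andP[/andP[pp _] /andP[yps _]]; split=> //.
    rewrite -(leq_pmul2r y0); apply: (@leq_trans (p ^ 2 * (256 ^ a) ^ 4)).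
      rewrite (expnM _ 2 2) -expnMn mulnn leq_exp2r //; exact: ltnW.
    by rewrite leq_mul2l s4 orbT.
  move=> ho; have lnx : lg n <= lg x by apply: leq_trunc_log.
  have : o * lg y < (3 * u.+1) * lg y.
    apply: (@leq_ltn_trans (3 * lg x)); first by nia.
    by rewrite -mulnA ltn_pmul2l.
  rewrite ltn_pmul2r //; lia.
pose S := harmonic R W y; pose T := harmonic R P y.
have aS : (a%:R <= 256 * (lg y)%:R * S)%R by apply: harmonic_window_ge.
have lT : ((lg y)%:R * T <= h%:R)%R.
  by rewrite /h natrM; exact: harmonic_top_le.
have S0 : (0 < S)%R.
  have a0' : (0 < a%:R :> R)%R by rewrite ltr0n.
  have := lt_le_trans a0' aS; rewrite pmulr_rgt0 // mulr_gt0 // ltr0n //.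
have T0 : (0 <= T)%R by apply: harmonic_ge0.
set N := count_sieved z y x'.
pose A : R := (((2 * (6 * u)) ^ g * (B * N))%:R / S ^+ g)%R.
have hW p : W p -> [/\ prime_in z y p, y < p * (256 ^ a) ^ 2 & p * 256 ^ a <= y].
  by case/andP => -> /andP[-> ->].
have hbase x1 t : r0.+1 <= t -> t <= y -> x1 <= x' ->
     t * count_sieved z y (x1 %/ t) <= B * count_sieved z y x1.
  move=> rt ty x1x; apply: leq_trans (Hr0 y x1 t (ltnW rt) ty) _.
  rewrite leq_mul2r /B leq_mul2l leq_trunc_log ?orbT //; exact: leq_trans x'x.
have hj' n : 0 < n -> n <= x' -> \sum_(0 <= p < y.+1 | W p && (p %| n)) 1 <= 6 * u.
  by move=> n0 nx; apply: hj => //; apply: leq_trans x'x.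
have hA t : y ^ g <= t * Q ^ g -> t <= y ^ g ->
     ((t * count_sieved z y (x' %/ t))%:R <= A)%R.
  move=> t1 t2; rewrite ler_pdivlMr ?exprn_gt0 //.
  have := count_sieved_swap R hW say (ltn0Sn r0) Q0 rs hbase hj' (addn0 g) (leqnn x').
  by apply; rewrite ?muln0 expn0 !muln1.
have hP p : P p -> prime_in z y p /\ y < p * Q by case/andP.
have ck : c + g <= u %/ 8.
  apply: (@leq_trans (c * 2)); first lia.
  by rewrite leq_divRL // -mulnA; apply: leq_trans (leq_trunc_div u 32); rewrite -/c; lia.
have rich : ((c ^ g * count_rich z y P (u %/ 8) x')%:R <= T ^+ g * A)%R.
  have := count_rich_le hP hA (addn0 g) ck (t := 1).
  by rewrite divn1 !mul1n; apply.
move: rich; set r := count_rich _ _ _ _ _ => rich.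
have {}rich : ((c ^ g * r)%:R * S ^+ g <= T ^+ g * ((2 * (6 * u)) ^ g * (B * N))%:R)%R.
  by rewrite -ler_pdivlMr ?exprn_gt0 // -mulrA.
have main : r * a ^ g <= H ^ g * (B * N).
  rewrite -(leq_pmul2l (_ : 0 < c ^ g)) ?expn_gt0 ?c0 // -(ler_nat R).
  apply: (@le_trans _ _ ((256 * (lg y)%:R) ^+ g * ((c ^ g * r)%:R * S ^+ g)))%R.
    have -> : ((c ^ g * (r * a ^ g))%:R = (c ^ g * r)%:R * a%:R ^+ g :> R)%R.
      by rewrite !natrM !natrX mulrA.
    have S1 : (0 <= 256 * (lg y)%:R * S)%R by rewrite !mulr_ge0 // ltW.
    by rewrite [leRHS]mulrCA -exprMn ler_wpM2l // lerXn2r ?nnegrE.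
  apply: (@le_trans _ _ ((256 * (lg y)%:R) ^+ g * (T ^+ g * ((2 * (6 * u)) ^ g * (B * N))%:R)))%R.
    by rewrite ler_wpM2l // exprn_ge0 // mulr_ge0.
  have -> : ((c ^ g * (H ^ g * (B * N)))%:R = (c * H)%:R ^+ g * (B * N)%:R :> R)%R.
    by rewrite mulnA -expnMn natrM natrX.
  rewrite natrM natrX !mulrA -!exprMn ler_wpM2r // lerXn2r ?nnegrE //.
    by rewrite !mulr_ge0.
  rewrite -[(256 * _ * T)%R]mulrA.
  apply: (@le_trans _ _ (256 * h%:R * (2 * (6 * (64 * c)))%:R)%R).
    apply: ler_pM => //; first by rewrite !mulr_ge0.
      by rewrite ler_wpM2l.
    by rewrite ler_nat !leq_mul2l uc.
  by rewrite -[256%R]/(256%:R)%R -!natrM ler_nat /H; lia.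
rewrite -(leq_pmul2r (_ : 0 < a ^ g)) ?expn_gt0 ?a0 //.
rewrite -mulnA; apply: (leq_trans (leq_mul (leqnn 8) main)).
rewrite (mulnC N); apply: (@leq_trans (80 * lg y * lg x * H ^ g * N)).
  by rewrite /B; lia.
by rewrite leq_mul2r par orbT.
Qed.

Lemma rich_rare z Q : 0 < Q -> exists K y0, forall y x,
  y0 <= y -> lg x ^ K <= y -> 128 * lg y <= lg x -> forall x', x' <= x ->
  8 * count_rich z y [pred p | prime_in z y p && (y < p * Q)]
        (lg x %/ lg y %/ 8) x' <= count_sieved z y x'.
Proof. exact: (rich_rare_over rat). Qed.

(** * Size and logarithmic weight of a typical number *)

Lemma leq_sum_range (a b : nat) (P Q : pred nat) (F : nat -> nat) :
  (forall p, p < a -> P p -> (p < b) && Q p) ->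
  \sum_(0 <= p < a | P p) F p <= \sum_(0 <= p < b | Q p) F p.
Proof.
move=> PQ; rewrite (big_nat_widen _ _ _ _ _ (leq_maxl a b)).
rewrite [leqRHS](big_nat_widen _ _ _ _ _ (leq_maxr a b)).
by apply: leq_sum_pred => p /andP[Pp pa]; rewrite andbC PQ.
Qed.

(** The logarithm of the squarefree kernel of n, up to a factor 2. *)
Definition weight z y n := \sum_(0 <= p < y.+1 | prime_in z y p && (p %| n)) lg p.

Lemma weight_le z y n : 0 < n -> weight z y n <= lg n.
Proof. by move=> n0; apply: sum_lg_dvd_sub => // p /andP[]. Qed.

(** s takes half of each exponent, rounded down, so that at most one copy of each
    prime is left over. *)
Lemma square_part n : 0 < n ->
  exists s, s ^ 2 %| n /\ n <= s ^ 2 * \prod_(0 <= p < n.+1 | prime p && (p %| n)) p.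
Proof.
move=> n0; exists (\prod_(0 <= p < n.+1) p ^ (logn p n)./2).
have nE : n = \prod_(0 <= p < n.+1) p ^ logn p n by rewrite -{1}(partnT n0).
have half p : (logn p n)./2 + (logn p n)./2 + odd (logn p n) = logn p n.
  by rewrite addnn addnC odd_double_half.
split.
  rewrite {3}nE -mulnn -big_split /=.
  apply: (big_ind2 (fun a b => a %| b)) => // [a b c d|p _]; first exact: dvdn_mul.
  by rewrite -expnD -{3}half; apply: dvdn_exp2l; rewrite leq_addr.
rewrite {1}nE -mulnn [X in _ <= _ * X]big_mkcond -!big_split /=.
apply: leq_prod => p _; rewrite -expnD -{1}half expnD leq_mul2l; apply/orP; right.
case: (posnP (logn p n)) => [->|l0].
  by rewrite expn0; case: ifP => // /andP[/prime_gt0].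
have := l0; rewrite logn_gt0 mem_primes => /and3P[pp _ pn].
by rewrite pp pn /=; case: (odd (logn p n)); rewrite ?expn1 ?expn0 ?prime_gt0.
Qed.

(** Remove prime factors, none of which exceeds y, until the quotient is at most
    D * y. *)
Lemma greedy_divisor y D s : 0 < y -> 0 < D -> D < s ->
  (forall p, prime p -> p %| s -> p <= y) ->
  exists2 d, d %| s & D < d <= D * y.
Proof.
move=> y0 D0; elim/ltn_ind: s => s IH Ds sy.
have [sD|sD] := leqP s (D * y); first by exists s => //; rewrite Ds.
have s1 : 1 < s by apply: leq_ltn_trans sD; rewrite muln_gt0 D0.
have pp := pdiv_prime s1; have ps := pdiv_dvd s; have p0 := prime_gt0 pp.
have s'E : s %/ pdiv s * pdiv s = s by rewrite divnK.
case: (IH (s %/ pdiv s)) => [| |p qp qs|d ds Dd].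
- by rewrite ltn_Pdiv ?prime_gt1 // (ltn_trans _ s1).
- rewrite -(ltn_pmul2r p0) s'E; apply: leq_ltn_trans sD.
  by rewrite leq_mul2l sy ?orbT.
- by apply: sy => //; rewrite -s'E dvdn_mulr.
by exists d => //; rewrite -s'E dvdn_mulr.
Qed.

(** A number of small weight is small or has a large square divisor s^2; the greedy
    divisor d of s brings the square into a range where a union bound is cheap. *)
Lemma light_cases z y n L : sieved z y n -> 24 * lg y <= L -> 0 < lg y ->
  4 * weight z y n < L ->
  n * y ^ 2 < 2 ^ L \/ exists2 d, y ^ 2 < d <= y ^ 3 & d ^ 2 %| n.
Proof.
move=> /sievedP[n0 npr] yL ly0 wL.
have y0 : 0 < y by case: (y) ly0; rewrite ?trunc_log0.
have [s [sn ns]] := square_part n0.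
have s0 : 0 < s by move: (dvdn_gt0 n0 sn); rewrite expn_gt0 orbF.
have [sy|sy] := ltnP (y ^ 2) s.
  right; case: (@greedy_divisor y (y ^ 2) s) => //; first by rewrite expn_gt0 y0.
    move=> p pp ps; have pn : p %| n by apply: dvdn_trans sn; rewrite -mulnn dvdn_mulr.
    by have /andP[] := npr p pp pn.
  move=> d ds dy; exists d; first by rewrite (expnSr y 2).
  by apply: dvdn_trans sn; apply: dvdn_exp2r.
left.
have rad : \prod_(0 <= p < n.+1 | prime p && (p %| n)) p <= 2 ^ (weight z y n).*2.
  apply: leq_trans (prod_lt_exp2_sum_lg _ _) _; first by move=> p /andP[].
  rewrite leq_exp2l // leq_double; apply: leq_sum_range => p _ /andP[pp pn].
  by rewrite ltnS /prime_in pp pn /=; have /andP[-> ->] := npr p pp pn.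
apply: (@leq_ltn_trans (y ^ 6 * 2 ^ (weight z y n).*2)).
  have -> : y ^ 6 * 2 ^ (weight z y n).*2 = ((y ^ 2) ^ 2 * 2 ^ (weight z y n).*2) * y ^ 2 by ring.
  rewrite leq_mul2r; apply/orP; right; apply: leq_trans ns _.
  by rewrite leq_mul // leq_exp2r.
apply: (@leq_trans (2 ^ (6 * (lg y).+1) * 2 ^ (weight z y n).*2)).
  by rewrite ltn_pmul2r ?expn_gt0 // mulnC expnM ltn_exp2r // lg_gt.
rewrite -expnD leq_exp2l //; lia.
Qed.

Definition count_light z y L x :=
  \sum_(1 <= n < x.+1) (sieved z y n && (4 * weight z y n < L)).

Lemma count_sieved_sum z y x X : x <= X ->
  count_sieved z y x = \sum_(1 <= n < X.+1) sieved z y n * (n <= x).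
Proof.
move=> xX; rewrite (@big_cat_nat _ _ _ x.+1) //= [X in _ + X]big_nat_cond.
rewrite [X in _ + X]big1 ?addn0 => [|n /andP[/andP[xn _] _]]; last by rewrite leqNgt xn muln0.
rewrite /count_sieved big_nat_cond [RHS]big_nat_cond; apply: eq_bigr => n /andP[/andP[_ nx] _].
by rewrite -ltnS nx muln1.
Qed.

Lemma count_light_le z y L x : 24 * lg y <= L -> 0 < lg y ->
  2 ^ L <= x.+1 * y ->
  count_light z y L x <= count_sieved z y (x %/ y) + y ^ 3 * count_sieved z y (x %/ y ^ 4).
Proof.
move=> yL ly0 Lx.
have y0 : 0 < y by case: (y) ly0; rewrite ?trunc_log0.
apply: (@leq_trans (\sum_(1 <= n < x.+1) (sieved z y n * (n <= x %/ y) +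
   \sum_((y ^ 2).+1 <= d < (y ^ 3).+1) (d ^ 2 %| n) * sieved z y n))).
  rewrite /count_light big_nat_cond [leqRHS]big_nat_cond; apply: leq_sum => n /andP[/andP[_ nx] _].
  case: (boolP (sieved z y n)) => //= sn; case: (ltnP _ L) => // wL.
  case: (light_cases sn yL ly0 wL) => [h|[d dy dn]].
    suff -> : n <= x %/ y by [].
    rewrite leq_divRL // -ltnS -(ltn_pmul2r y0) -mulnA mulnn.
    exact: leq_trans h Lx.
  apply: leq_trans (leq_addl _ _).
  rewrite (bigD1_seq d) ?iota_uniq ?mem_index_iota //= ?dn //.
rewrite big_split /= -count_sieved_sum ?leq_div // leq_add2l exchange_big /=.
apply: (@leq_trans (\sum_((y ^ 2).+1 <= d < (y ^ 3).+1) count_sieved z y (x %/ y ^ 4))).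
  rewrite big_nat_cond [leqRHS]big_nat_cond; apply: leq_sum => d /andP[/andP[yd _] _].
  have d2 : 0 < d ^ 2 by rewrite expn_gt0 (leq_ltn_trans _ yd).
  rewrite (sum_multiples _ (fun n => sieved z y n : nat)) //.
  apply: (@leq_trans (count_sieved z y (x %/ d ^ 2))).
    by apply: leq_sum => m _; rewrite sievedM; case: (sieved z y m); rewrite ?andbF ?leq_b1.
  apply: count_sieved_mono; apply: leq_div2l; first by rewrite expn_gt0 y0.
  by rewrite (expnM y 2 2) leq_exp2r // ltnW.
by rewrite sum_nat_const_nat leq_mul2r subSS leq_subr orbT.
Qed.

Lemma polylog_small : exists y0, forall y L, y0 <= y -> L ^ 8 <= y ->
  16 * (10 * lg y * L) ^ 4 <= y.
Proof.
have [y1 H] := lg_dominated 8 ((16 * 10 ^ 4) ^ 2).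
exists y1 => y L yy Ly.
rewrite -(leq_exp2r _ _ (isT : 0 < 2)) -[y ^ 2]mulnn.
apply: leq_trans (leq_mul (H _ yy) Ly).
move: (10) => a; move: (16) => b; apply/eq_leq; ring.
Qed.

Lemma count_sieved_div_pow z : exists r0, forall y x L k, r0 <= y -> lg x <= L ->
  y ^ k * count_sieved z y (x %/ y ^ k) <= (10 * lg y * L) ^ k * count_sieved z y x.
Proof.
have [r0 H] := count_sieved_div_weak z; exists r0 => y x L k ry xL.
elim: k => [|k IH]; first by rewrite !expn0 divn1.
have step : y * count_sieved z y (x %/ y ^ k.+1) <=
    10 * lg y * L * count_sieved z y (x %/ y ^ k).
  rewrite expnSr divnMA; apply: leq_trans (H y (x %/ y ^ k) y ry (leqnn y)) _.
  rewrite leq_mul2r leq_mul2l; apply/orP; right; apply/orP; right.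
  by apply: leq_trans xL; apply: leq_trunc_log; rewrite leq_div.
set c := count_sieved z y (x %/ y ^ k.+1) in step *.
rewrite expnSr -mulnA [(10 * lg y * L) ^ k.+1]expnS.
apply: (leq_trans (leq_mul (leqnn (y ^ k)) step)).
by rewrite mulnCA -[leqRHS]mulnA leq_mul2l IH orbT.
Qed.

(** Small numbers and multiples of large squares are rare because the bound for
    N(x / y^k) loses only a power of log x * log y, against a power of y. *)
Lemma light_rare z : exists y0, forall y L x, y0 <= y -> L ^ 8 <= y ->
  24 * lg y <= L -> lg x <= L -> 2 ^ L <= x.+1 * y ->
  8 * count_light z y L x <= count_sieved z y x.
Proof.
have [y1 H1] := polylog_small; have [y2 H2] := count_sieved_div_pow z.
exists (y1 + y2 + 2) => y L x yy Ly yL xL Lx.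
have y1y : y1 <= y by lia.
have y2y : y2 <= y by lia.
have y0 : 0 < y by lia.
have ly0 : 0 < lg y by rewrite trunc_log_gt0 /=; lia.
have := count_light_le z yL ly0 Lx.
have := H1 _ _ y1y Ly; have := H2 y x L 1 y2y xL; have := H2 y x L 4 y2y xL.
rewrite !expn1; set A := 10 * lg y * L; set n1 := count_sieved z y (_ %/ y).
set n4 := count_sieved z y (_ %/ y ^ 4); set n := count_sieved z y x.
move=> h4 h1 hA hl.
have A0 : 0 < A by rewrite !muln_gt0 ly0 /=; lia.
have hA1 : 16 * A <= y.
  by apply: leq_trans hA; rewrite leq_mul2l -{1}(expn1 A) leq_pexp2l.
have b1 : 16 * n1 <= n.
  rewrite -(leq_pmul2l y0); apply: (@leq_trans (16 * A * n)); first by nia.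
  by rewrite leq_mul2r hA1 orbT.
have b4 : 16 * (y ^ 3 * n4) <= n.
  rewrite -(leq_pmul2l y0); apply: (@leq_trans (16 * A ^ 4 * n)).
    apply: (@leq_trans (16 * (y ^ 4 * n4))); first by apply/eq_leq; rewrite (expnS y 3); ring.
    by rewrite -mulnA leq_mul2l h4 orbT.
  by rewrite leq_mul2r hA orbT.
lia.
Qed.

(** * Growth of the count under bounded factors *)

Definition theta_gt z s := \sum_(0 <= p < s.+1 | prime p && (z < p)) lg p.

Lemma theta_gt_mono z m n : m <= n -> theta_gt z m <= theta_gt z n.
Proof.
by move=> mn; apply: leq_sum_range => p pm ->; rewrite andbT; apply: leq_trans pm _.
Qed.

Lemma theta_gt_le z n : theta_gt z n <= 4 * n.
Proof.
apply: leq_trans (theta_le n).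
by apply: leq_sum_pred => p /andP[].
Qed.

Lemma sum_prime_div z y x X (P : pred nat) (w : nat -> nat) : x <= X ->
  \sum_(0 <= p < y.+1 | prime_in z y p && P p) w p * count_sieved z y (x %/ p) =
  \sum_(1 <= m < X.+1) sieved z y m *
    \sum_(0 <= p < y.+1 | prime_in z y p && P p && (p <= x %/ m)) w p.
Proof.
move=> xX.
transitivity (\sum_(0 <= p < y.+1 | prime_in z y p && P p)
   \sum_(1 <= m < X.+1) w p * (sieved z y m * (p <= x %/ m))).
  apply: eq_bigr => p /andP[/andP[pp _] _].
  rewrite (@count_sieved_sum _ _ _ X) ?big_distrr /=; last first.
    by apply: leq_trans xX; rewrite leq_div.
  rewrite big_nat_cond [RHS]big_nat_cond; apply: eq_bigr => m /andP[/andP[m0 _] _].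
  suff -> : (m <= x %/ p) = (p <= x %/ m) by [].
  by rewrite !leq_divRL // ?(prime_gt0 pp) // mulnC.
rewrite exchange_big /=; apply: eq_bigr => m _; rewrite [in RHS]big_mkcondr big_distrr /=.
by apply: eq_bigr => p _; case: (p <= _); rewrite ?muln1 ?muln0 // mulnC.
Qed.

Lemma sum_prime_le z y s t : s = minn y t ->
  \sum_(0 <= p < y.+1 | prime_in z y p && (p <= t)) lg p = theta_gt z s.
Proof.
move=> ->; apply/eqP; rewrite eqn_leq; apply/andP; split; apply: leq_sum_range => p.
  by rewrite ltnS => py /andP[/andP[-> /andP[-> _]] pt]; rewrite ltnS leq_min py pt.
by rewrite ltnS leq_min => /andP[py pt] /andP[pp zp]; rewrite ltnS /prime_in py pp zp pt.
Qed.

(** Grouping the pairs p | n by m = n / p turns the sum of weights into a sum of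
    Chebyshev functions, which is what relates the counts for different x. *)
Lemma sum_weight z y x X : x <= X ->
  \sum_(1 <= n < x.+1) sieved z y n * weight z y n =
  \sum_(1 <= m < X.+1) sieved z y m * theta_gt z (minn y (x %/ m)).
Proof.
move=> xX.
rewrite (@double_count_sieved z y (prime_in z y) lg) //.
rewrite (eq_bigl (fun p => prime_in z y p && predT p)) => [|p]; last by rewrite andbT.
rewrite (sum_prime_div _ _ _ _ xX); apply: eq_bigr => m _; congr (_ * _).
rewrite -(@sum_prime_le z y _ (x %/ m)) //; apply: eq_bigl => p; by rewrite andbT.
Qed.

Lemma sum_weight_le z y x : 
  \sum_(1 <= n < x.+1) sieved z y n * weight z y n <= lg x * count_sieved z y x.
Proof.
rewrite /count_sieved big_distrr /= big_nat_cond [leqRHS]big_nat_cond.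
apply: leq_sum => n /andP[/andP[n0 nx] _].
rewrite mulnC leq_mul2r; apply/orP; right.
by apply: leq_trans (weight_le z y n0) (leq_trunc_log 2 _).
Qed.

Lemma sum_weight_ge z y L x : 8 * count_light z y L x <= count_sieved z y x ->
  7 * L * count_sieved z y x <=
  32 * \sum_(1 <= n < x.+1) sieved z y n * weight z y n.
Proof.
move=> h.
have : L * count_sieved z y x <= L * count_light z y L x +
    4 * \sum_(1 <= n < x.+1) sieved z y n * weight z y n.
  rewrite /count_sieved /count_light !big_distrr /= -big_split /=.
  apply: leq_sum => n _; case: (sieved z y n); rewrite /= ?muln0 ?mul0n //.
  by case: ltnP => /=; rewrite ?muln1 ?muln0 ?mul1n; lia.
nia.
Qed.

(** Chebyshev's bounds compare theta(x / m) with j theta(x / (j m)), except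
    for m so close to x that theta(x / (j m)) is degenerate.  These m contribute
    O(j N(x)), less than the main term which is of order N(x) log x. *)
Lemma count_sieved_div_lower z J : exists y0, forall y x j, y0 <= y -> lg x ^ 8 <= y ->
  24 * lg y <= lg x -> 0 < j <= J ->
  count_sieved z y x <= 1000 * j * count_sieved z y (x %/ j).
Proof.
have [y1 H1] := light_rare z; have [r1 H0] := theta_gt_lower z; pose r0 := r1.+1.
exists (y1 + 2 ^ (256 * J * r0 + 1)) => y x j yy Ly yL /andP[j0 jJ].
have y0 : 0 < y by apply: leq_trans yy; rewrite addn_gt0 expn_gt0 orbT.
have ly : 256 * J * r0 + 1 <= lg y.
  by apply: trunc_log_max => //; apply: leq_trans yy; rewrite leq_addl.
have x0 : 0 < x by case: (x) yL; rewrite ?trunc_log0 //; lia.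
have lx : 2 ^ lg x <= x.+1 * y by apply: leq_trans (lg_le x0) _; nia.
have := sum_weight_ge (H1 y (lg x) x (leq_trans (leq_addr _ _) yy) Ly yL (leqnn _) lx).
have := sum_weight_le z y (x %/ j).
rewrite (sum_weight _ _ (leqnn x)) (sum_weight _ _ (leq_div x j)).
set S1 := \sum_(_ <= _ < _) _; set S2 := \sum_(_ <= _ < _) _.
set n1 := count_sieved z y (x %/ j); set n := count_sieved z y x.
(* The second term accounts for the m with x / (j m) < r0. *)
have hS : S2 <= 160 * j * S1 + 8 * j * r0 * n.
  rewrite /S1 /S2 /n /count_sieved !big_distrr /= -big_split /=.
  apply: leq_sum => m _; case: (sieved z y m) => //=; rewrite !mul1n !muln1.
  set s := minn y (x %/ m).
  have s2 : s %/ j <= minn y (x %/ j %/ m).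
    rewrite leq_min (leq_trans (leq_div _ _)) ?geq_minl //=.
    by rewrite -divnMA mulnC divnMA leq_div2r // geq_minr.
  have := theta_gt_le z s; have := ltn_ceil s j0; have := theta_gt_mono z s2.
  set a := s %/ j; set c := theta_gt z s; set d := theta_gt z (minn _ (_ %/ m)) => bd sa cs.
  have cs' : c <= 4 * (a.+1 * j) by apply: leq_trans cs _; rewrite leq_mul2l ltnW.
  apply: leq_trans cs' _; rewrite mulnA.
  have [ar|ar] := leqP r0 a.
    have h : 4 * a.+1 <= 160 * d.
      have := H0 _ (ltnW ar); rewrite -/(theta_gt z a).
      have a0 : 0 < a by apply: leq_ltn_trans ar.
      by move: bd a0; clear; lia.
    apply: leq_trans (leq_addr _ _); apply: leq_trans (leq_mul h (leqnn j)) _.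
    by apply/eq_leq; ring.
  have h : 4 * a.+1 <= 8 * r0 by move: ar; clear; lia.
  apply: leq_trans (leq_addl _ _); apply: leq_trans (leq_mul h (leqnn j)) _.
  by apply/eq_leq; ring.
move=> h1 h2.
have lL : lg (x %/ j) <= lg x by apply: leq_trunc_log; rewrite leq_div.
have e1 : 256 * j * r0 <= lg x.
  apply: (@leq_trans (256 * J * r0)); first by rewrite !leq_mul.
  by apply: leq_trans yL; lia.
have L0 : 0 < lg x by lia.
rewrite -(leq_pmul2l L0).
set L := lg x in h2 e1 L0 lL *; set L' := lg (x %/ j) in h1 lL.
have h3 : S1 <= L * n1 by apply: leq_trans h1 _; rewrite leq_mul2r lL orbT.
have h4 : 256 * j * r0 * n <= L * n by rewrite leq_mul2r e1 orbT.
have h5 : j * S1 <= j * (L * n1) by rewrite leq_mul2l h3 orbT.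
have E : L * (1000 * j * n1) = 1000 * (j * (L * n1)) by ring.
rewrite E; move: h4 hS; rewrite -!mulnA; lia.
Qed.

(** Only the primes up to y / q are counted on the side of x / q, so that
    passing from x to x / q divides both arguments of min(y, x / m) by q.  A number
    which is neither light nor rich has a positive proportion of its logarithm in these
    primes. *)
Lemma count_sieved_div_upper z Q : 0 < Q -> exists K y0, forall y x q, y0 <= y ->
  lg x ^ K <= y -> 128 * lg y <= lg x -> 0 < q <= Q ->
  q * count_sieved z y (x %/ q) <= 1000 * count_sieved z y x.
Proof.
move=> Q0; have [K [y1 Hr]] := rich_rare z Q0.
have [y2 Hl] := light_rare z; have [r0 H0] := theta_gt_lower z.
exists (maxn K 8), (y1 + y2 + 2 ^ (r0 + 1) + 2 * Q) => y x q yy Ly yL /andP[q0 qQ].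
have y0 : 0 < y by lia.
have ly : r0 + 1 <= lg y by apply: trunc_log_max => //; lia.
have L0 : 0 < lg x by lia.
have LK : lg x ^ K <= y by apply: leq_trans Ly; rewrite leq_pexp2l // leq_maxl.
have L8 : lg x ^ 8 <= y by apply: leq_trans Ly; rewrite leq_pexp2l // leq_maxr.
have x0 : 0 < x by case: (x) L0; rewrite ?trunc_log0.
set x' := x %/ q.
have x'x : x' <= x by apply: leq_div.
have lx' : lg x' <= lg x by apply: leq_trunc_log.
have xx' : 2 ^ lg x <= x'.+1 * y.
  apply: leq_trans (lg_le x0) _; have := ltn_ceil x q0; rewrite -/x' => h.
  apply: leq_trans (ltnW h) _; rewrite leq_mul2l; apply/orP; right; lia.
have yL' : 24 * lg y <= lg x by lia.
have hl := Hl y (lg x) x' ltac:(lia) L8 yL' lx' xx'.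
have hr := Hr y x ltac:(lia) LK yL x' x'x.
set k := lg x %/ lg y %/ 8 in hr.
set P := [pred p | prime_in z y p && (y < p * Q)] in hr.
pose f n := \sum_(0 <= p < y.+1 | (prime_in z y p && (p * q <= y)) && (p %| n)) lg p.
have k8 : 8 * k * lg y <= lg x.
  rewrite mulnC; apply: (@leq_trans (lg y * (lg x %/ lg y))).
    by rewrite leq_mul2l mulnC leq_trunc_div orbT.
  by rewrite mulnC leq_trunc_div.
have split n : weight z y n <= f n + lg y * omega P y n.
  rewrite /weight /f /omega big_distrr /= big_mkcond [X in _ <= X + _]big_mkcond.
  rewrite [X in _ <= _ + X]big_mkcond -big_split /=.
  rewrite big_nat_cond [leqRHS]big_nat_cond; apply: leq_sum => p /andP[/andP[_ py] _].
  case: (boolP (prime_in z y p)) => //= pz; case: (boolP (p %| n)) => pn; rewrite ?andbF //= !andbT.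
  case: (leqP (p * q) y) => //= h; first by rewrite leq_addr.
  have -> : y < p * Q by apply: leq_trans h _; rewrite leq_mul2l qQ orbT.
  by rewrite add0n muln1; apply: leq_trunc_log.
have lower : 3 * lg x * count_sieved z y x' <=
    32 * \sum_(1 <= n < x'.+1) sieved z y n * f n.
  have : lg x * count_sieved z y x' <= lg x * count_light z y (lg x) x' +
     lg x * count_rich z y P k x' + 8 * \sum_(1 <= n < x'.+1) sieved z y n * f n.
    rewrite /count_sieved /count_light /count_rich !big_distrr /= -!big_split /=.
    apply: leq_sum => n _; case: (sieved z y n); rewrite /= ?muln0 ?mul0n //.
    case: (ltnP _ (lg x)) => h1 /=; first by rewrite muln1; lia.
    case: (leqP k _) => h2 /=; first by rewrite muln1; lia.
    have := split n; set o := omega _ _ _ in h2 *; set w := weight _ _ _ in h1 *.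
    rewrite !muln1 !muln0 mul1n !add0n => hw.
    have : 8 * (lg y * o) <= lg x.
      by apply: leq_trans k8; rewrite -mulnA leq_mul2l mulnC leq_mul2r (ltnW h2) !orbT.
    by move: hw h1; clear; lia.
  move=> tot; have hl' : lg x * (8 * count_light z y (lg x) x') <= lg x * count_sieved z y x'.
    by rewrite leq_mul2l hl orbT.
  have hr' : lg x * (8 * count_rich z y P k x') <= lg x * count_sieved z y x'.
    by rewrite leq_mul2l hr orbT.
  rewrite -mulnA; rewrite mulnCA in hl'; rewrite mulnCA in hr'.
  by move: tot hl' hr'; clear; lia.
have upper : q * (\sum_(1 <= n < x'.+1) sieved z y n * f n) <=
    80 * \sum_(1 <= m < x.+1) sieved z y m * theta_gt z (minn y (x %/ m)) +
    4 * r0 * count_sieved z y x.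
  rewrite /f (@double_count_sieved z y (fun p => prime_in z y p && (p * q <= y)) lg); last by move=> p /andP[].
  rewrite (sum_prime_div _ _ _ _ x'x) /count_sieved !big_distrr /= -big_split /=.
  apply: leq_sum => m _; case: (sieved z y m); rewrite /= ?muln0 ?mul0n // !mul1n !muln1.
  set s := minn y (x %/ m).
  have -> : \sum_(0 <= p < y.+1 | prime_in z y p && (p * q <= y) && (p <= x' %/ m)) lg p =
     theta_gt z (s %/ q).
    have sE : s %/ q = minn (y %/ q) (x' %/ m).
      rewrite /s /x' -divnMA (mulnC q) divnMA /minn.
      case: (ltnP y (x %/ m)) => h; case: ltnP => // h'.
        by apply/eqP; rewrite eqn_leq h' leq_div2r // ltnW.
      by apply/eqP; rewrite eqn_leq (ltnW h') leq_div2r.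
    rewrite sE; apply/eqP; rewrite eqn_leq; apply/andP; split; apply: leq_sum_range => p.
      rewrite ltnS => py /andP[/andP[/andP[-> /andP[-> _]] pq] pt].
      by rewrite ltnS leq_min pt leq_divRL // pq.
    rewrite ltnS leq_min leq_divRL // => /andP[pq pt] /andP[pp zp].
    have py : p <= y by apply: leq_trans pq; rewrite leq_pmulr.
    by rewrite ltnS py /prime_in pp zp py pq pt.
  have qb : q * theta_gt z (s %/ q) <= 4 * s.
    apply: leq_trans (leq_mul (leqnn q) (theta_gt_le z (s %/ q))) _.
    by rewrite mulnCA leq_mul2l mulnC leq_trunc_div orbT.
  apply: (leq_trans qb).
  have [sr|sr] := leqP r0 s.
    have := H0 _ sr; rewrite -/(theta_gt z s) => h.
    by apply: leq_trans (leq_addr _ _); move: h; clear; lia.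
  by apply: leq_trans (leq_addl _ _); rewrite leq_mul2l ltnW.
have := sum_weight_le z y x; rewrite (sum_weight _ _ (leqnn x)) => top.
rewrite -(leq_pmul2l L0).
set S := \sum_(_ <= _ < _) _ in lower upper; set S' := \sum_(_ <= _ < _) _ in upper top.
set n' := count_sieved _ _ _ in lower *; set n := count_sieved _ _ _ in upper top *.
have h1 : q * (3 * lg x * n') <= q * (32 * S) by rewrite leq_mul2l lower orbT.
have h2 : 4 * r0 * n <= 4 * (lg x * n) by rewrite -mulnA !leq_mul2l leq_mul2r; apply/orP; right; apply/orP; right; lia.
have E1 : q * (3 * lg x * n') = 3 * (lg x * (q * n')) by ring.
have E2 : q * (32 * S) = 32 * (q * S) by ring.
have E3 : lg x * (1000 * n) = 1000 * (lg x * n) by ring.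
rewrite E1 E2 in h1; rewrite E3; move: h1 h2 upper top; clear; lia.
Qed.

(** * Sets without three-term progressions *)

Definition ap_free (A : pred nat) :=
  forall a d, 0 < d -> A a -> A (a + d) -> A (a + d.*2) -> False.

Definition count_in (A : pred nat) a b := \sum_(a <= n < b) A n.

Lemma ap_free_affine A b d : 0 < d -> ap_free A -> ap_free (fun i => A (b + d * i)).
Proof.
move=> d0 hA a e e0 h1 h2 h3; apply: (hA (b + d * a) (d * e)) => //.
- by rewrite muln_gt0 d0.
- by rewrite -addnA -mulnDr.
- by rewrite doubleMr -addnA -mulnDr.
Qed.

Lemma ap_free_shift A b : ap_free A -> ap_free (fun i => A (b + i)).
Proof.
move=> hA a e e0; rewrite !addnA; exact: hA.
Qed.

Lemma ap_free_sub (A B : pred nat) : (forall n, B n -> A n) -> ap_free A -> ap_free B.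
Proof. by move=> BA hA a d d0 /BA h1 /BA h2 /BA h3; apply: hA h3. Qed.

Lemma count_in_le A a b : count_in A a b <= b - a.
Proof.
apply: (@leq_trans (\sum_(a <= n < b) 1)); last by rewrite sum_nat_const_nat muln1.
by apply: leq_sum => n _; apply: leq_b1.
Qed.

Lemma count_in_cat A a b c : a <= b -> b <= c ->
  count_in A a c = count_in A a b + count_in A b c.
Proof. by move=> ab bc; rewrite /count_in (@big_cat_nat _ _ _ b). Qed.

Lemma count_in_shift A b l : count_in A b (b + l) = count_in (fun i => A (b + i)) 0 l.
Proof.
rewrite /count_in -{1}(add0n b) big_addn addKn.
by apply: eq_bigr => i _; rewrite addnC.
Qed.

(** Cut an interval into pieces of length l0, each of which inherits the bound by
    translation; the last incomplete piece costs l0. *)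
Lemma density_all (R : realFieldType) (r : R) l0 : (0 <= r)%R -> 0 < l0 ->
  (forall A, ap_free A -> ((count_in A 0 l0)%:R <= r * l0%:R)%R) ->
  forall A l, ap_free A -> ((count_in A 0 l)%:R <= r * l%:R + l0%:R)%R.
Proof.
move=> r0 l00 H A l; elim/ltn_ind: l A => l IH A hA.
have [ll|ll] := ltnP l l0.
  apply: le_trans (_ : l0%:R <= _)%R; last by rewrite lerDr mulr_ge0.
  by rewrite ler_nat; apply: leq_trans (count_in_le _ _ _) _; lia.
rewrite (@count_in_cat _ _ l0) //.
have := count_in_shift A l0 (l - l0); rewrite subnKC // => ->; rewrite natrD.
have := IH (l - l0) _ _ (ap_free_shift (b := l0) hA) => /(_ ltac:(lia)) h.
by have h' := H _ hA; rewrite natrB // mulrBr in h; lra.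
Qed.

(** The points a + (sum of a subset of ds). *)
Fixpoint cube a (ds : seq nat) : seq nat :=
  if ds is d :: ds' then cube a ds' ++ map (addn d) (cube a ds') else [:: a].

Lemma cube_base a ds : a \in cube a ds.
Proof. by elim: ds => [|d ds IH] /=; rewrite ?mem_seq1 // mem_cat IH. Qed.

Definition isolated D (A : pred nat) x := A x && ~~ has (fun d => A (x + d)) (iota 1 D).

(** Two isolated points are at distance more than D. *)
Lemma isolated_short D A a l : l <= D.+1 -> count_in (isolated D A) a (a + l) <= 1.
Proof.
elim: l => [|l IH] lD; first by rewrite addn0 /count_in big_geq.
rewrite addnS /count_in big_nat_recr ?leq_addr //=.
case: (boolP (isolated D A (a + l))) => iso /=; last by rewrite addn0; apply: IH; apply: ltnW.
rewrite big_nat_cond big1 // => x /andP[/andP[ax xa] _].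
apply/eqP; rewrite eqb0 negb_and negbK; apply/orP; right; apply/hasP.
exists (a + l - x); first by rewrite mem_iota; lia.
by rewrite subnKC ?(ltnW xa) //; case/andP: iso.
Qed.

Lemma isolated_count D A m : count_in (isolated D A) 0 (m * D.+1) <= m.
Proof.
elim: m => [|m IH]; first by rewrite mul0n /count_in big_geq.
rewrite (@count_in_cat _ _ (m * D.+1)) // ?leq_mul //.
by rewrite -[m.+1]addn1 leq_add // mulnDl mul1n isolated_short.
Qed.

(** Isolated points have density at most 1 / (D + 1), so if A is denser most of
    its points recur after one of the shifts d <= D. *)
Lemma recurrent_shift D A w : 0 < D ->
  D.+1 * (count_in A 0 w) <= w + D.+1 +
  D.+1 * (\sum_(1 <= d < D.+1) count_in (fun x => A x && A (x + d)) 0 w).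
Proof.
move=> D0.
have wm : w <= (w %/ D.+1).+1 * D.+1 by apply/ltnW/ltn_ceil.
have iso : count_in (isolated D A) 0 w <= (w %/ D.+1).+1.
  apply: leq_trans (isolated_count D A _).
  by rewrite [leqRHS](@count_in_cat _ _ w) // leq_addr.
have main : count_in A 0 w <= count_in (isolated D A) 0 w +
    \sum_(1 <= d < D.+1) count_in (fun x => A x && A (x + d)) 0 w.
  rewrite /count_in exchange_big -big_split /=; apply: leq_sum => x _.
  rewrite /isolated; case: (A x) => //=; case: (boolP (has _ _)) => //= /hasP[d dD Ad].
  rewrite add0n (bigD1_seq d) ?iota_uniq //=.
    by rewrite Ad.
  by rewrite /index_iota subn1.
have := leq_trunc_div w D.+1.
move: main iso; set s := \sum_(_ <= _ < _) _; set q := w %/ D.+1; nia.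
Qed.

(** Hilbert's cube lemma with bounded differences.  By pigeonhole some shift d
    satisfies x, x + d \in A for a positive proportion of x, and the lemma for these x
    gives a cube of lower dimension. *)
Lemma cube_exists (R : archiRealFieldType) k (delta : R) : (0 < delta)%R ->
  exists D w0, forall w (A : pred nat), w0 <= w -> (forall x, A x -> x < w) ->
    (delta * w%:R <= (count_in A 0 w)%:R)%R ->
    exists a ds, [/\ size ds = k, all (fun d => 0 < d <= D) ds & all A (cube a ds)].
Proof.
elim: k delta => [|k IH] delta delta0.
  exists 0, 1 => w A w1 Aw h.
  have : 0 < count_in A 0 w.
    by rewrite -(ltr_nat R); apply: lt_le_trans h; rewrite mulr_gt0 // ltr0n.
  rewrite /count_in lt0n sum_nat_seq_neq0 => /hasP[a _ /andP[_ Aa]].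
  by exists a, [::]; split=> //=; rewrite andbT; case: (A a) Aa.
pose D := (Num.bound (4 / delta)).+1.
have D1 : (4 <= delta * D.+1%:R)%R.
  rewrite mulrC -ler_pdivrMr //; apply: ltW.
  apply: lt_trans (archi_boundP _) _; first by rewrite divr_ge0 // ltW.
  by rewrite ltr_nat /D ltnS leqnSn.
(* The density of the points recurring after the most popular of the D shifts. *)
pose delta' : R := ((D.+1 ^ 2)%:R^-1)%R.
have delta'0 : (0 < delta')%R by rewrite invr_gt0 ltr0n expn_gt0.
have [D' [w0 H]] := IH _ delta'0.
exists (maxn D D'), (w0 + D.+1) => w A ww Aw h.
have w_gt0 : 0 < w by lia.
have rec := recurrent_shift A w (ltn0Sn _ : 0 < D).
have [/hasP[d]|/hasPn none] := boolP (has (fun d => (delta' * w%:R <= (count_in (fun x => A x && A (x + d)) 0 w)%:R)%R) (iota 1 D)).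
  rewrite mem_iota => dD cd.
  have w0w : w0 <= w by lia.
  have [x /andP[/Aw //]|a [ds [sds allds cub]]] := H w _ w0w _ cd.
  exists a, (d :: ds); split; first by rewrite /= sds.
    apply/andP; split; first by rewrite leq_max; lia.
    by apply: sub_all allds => e /andP[-> eD] /=; rewrite leq_max eD orbT.
  rewrite /= all_cat all_map; apply/andP; split; apply: sub_all cub => x /andP[] //=.
  by rewrite addnC.
exfalso.
have small : (\sum_(1 <= d < D.+1) count_in (fun x => A x && A (x + d)) 0 w) * D.+1 ^ 2 <= D * w.
  rewrite -[D in D * w](subn1 D.+1) -sum_nat_const_nat big_distrl /= big_nat_cond [leqRHS]big_nat_cond.
  apply: leq_sum => d /andP[/andP[d1 dD] _].
  have := none d; rewrite mem_iota => /(_ ltac:(lia)); rewrite -ltNge => cd.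
  rewrite -(ler_nat R) natrM -ler_pdivlMr ?ltr0n ?expn_gt0 // mulrC; exact: ltW.
have big : 4 * w <= D.+1 * count_in A 0 w.
  rewrite -(ler_nat R) !natrM; apply: (@le_trans _ _ (delta * D.+1%:R * w%:R))%R.
    by rewrite ler_wpM2r.
  by rewrite mulrAC mulrC ler_wpM2l.
move: rec small big ww; set s := \sum_(_ <= _ < _) _; set c := count_in _ _ _.
rewrite (_ : D.+1 ^ 2 = D.+1 * D.+1) // => rec small big ww.
have h2 : 2 * w <= D.+1 * s by move: rec big ww; clear; set a := D.+1 * c; set b := D.+1 * s; lia.
have h3 : 2 * w * D.+1 <= D * w.
  apply: leq_trans small; rewrite mulnA leq_mul2r (mulnC s) h2 orbT //.
by move: h3 w_gt0; clear; nia.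
Qed.

(** * Sets made of long runs *)

(** The number of maximal progressions of difference e contained in V. *)
Definition run_starts e (V : pred nat) n :=
  \sum_(0 <= y < n) (V y && ((y < e) || ~~ V (y - e))).

Lemma sum_pos (F : nat -> nat) a b i : a <= i < b -> F i <= \sum_(a <= j < b) F j.
Proof.
by move=> /andP[ai ib]; rewrite (@big_cat_nat _ _ _ i) ?(ltnW ib) //= [X in _ + X]big_ltn // addnCA leq_addr.
Qed.

(** A maximal run of V of length l contains at most r l + l0 points of A.  The
    induction keeps apart the last m points, which form an unfinished run. *)
Lemma run_bound (R : realFieldType) (r : R) l0 :
  (forall A l, ap_free A -> ((count_in A 0 l)%:R <= r * l%:R + l0%:R)%R) ->
  forall (A V : pred nat), ap_free A -> (forall i, A i -> V i) ->
  forall L m, (forall i, L <= i < L + m -> V i) ->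
  ((count_in A 0 (L + m))%:R <=
     r * (count_in V 0 (L + m))%:R + l0%:R * (run_starts 1 V (L + m))%:R)%R.
Proof.
move=> H A V hA AV.
have full a m : (forall i, a <= i < a + m -> V i) -> count_in V a (a + m) = m.
  move=> Vi; rewrite /count_in big_nat_cond (eq_bigr (fun=> 1)) => [|i /andP[/Vi -> _]] //.
  by rewrite -big_nat_cond sum_nat_const_nat muln1 addKn.
elim=> [|L IH] m Vi.
  rewrite add0n in Vi *; have cV := full 0 m Vi; rewrite add0n in cV; rewrite cV.
  case: m Vi {cV} => [|m] Vi.
    by rewrite /count_in big_geq // /run_starts big_geq // !mulr0 addr0.
  apply: le_trans (H _ _ hA) _; rewrite lerD2l ler_peMr // ler1n.
  apply: leq_trans (sum_pos _ (_ : 0 <= 0 < m.+1)) => //=.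
  by rewrite Vi.
have [VL|VL] := boolP (V L).
  have := IH m.+1; rewrite addnS addSn; apply=> i.
  by rewrite leq_eqVlt => /andP[/orP[/eqP <- //|Li] im]; apply: Vi; rewrite Li addSn.
have AL : A L = false by apply/negP => /AV; apply/negP.
have IH0 := IH 0; rewrite addn0 in IH0.
have {}IH0 := IH0 ltac:(by move=> i /andP[h1 h2]; move: (leq_trans h2 h1); rewrite ltnn).
have cA : count_in A 0 (L.+1 + m) = count_in A 0 L + count_in (fun i => A (L.+1 + i)) 0 m.
  rewrite (@count_in_cat _ _ L.+1) ?leq_addr // count_in_shift; congr (_ + _).
  by rewrite /count_in big_nat_recr //= AL addn0.
have cV : count_in V 0 (L.+1 + m) = count_in V 0 L + m.
  rewrite (@count_in_cat _ _ L.+1) ?leq_addr // (full _ _ Vi); congr (_ + _).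
  by rewrite /count_in big_nat_recr //= (negbTE VL) addn0.
have sV : run_starts 1 V L + (0 < m) <= run_starts 1 V (L.+1 + m).
  rewrite /run_starts [leqRHS](@big_cat_nat _ _ _ L.+1) ?leq_addr //=.
  apply: leq_add; first by rewrite big_nat_recr //= leq_addr.
  case: m Vi {cA cV} => [|m] Vi //=.
  apply: leq_trans (sum_pos _ (_ : L.+1 <= L.+1 < L.+1 + m.+1)); last by lia.
  by rewrite Vi ?subn1 /= ?VL ?orbT //; lia.
rewrite cA cV !natrD mulrDr.
have sV' : (l0%:R * (run_starts 1 V L)%:R + l0%:R * (0 < m)%:R <= l0%:R * (run_starts 1 V (L.+1 + m))%:R :> R)%R.
  by rewrite -mulrDr ler_wpM2l // -natrD ler_nat.
have h : ((count_in (fun i => A (L.+1 + i)) 0 m)%:R <= r * m%:R + l0%:R * (0 < m)%:R)%R.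
  case: m {Vi cA cV sV sV'} => [|m]; first by rewrite /count_in big_geq // !mulr0 addr0.
  by rewrite /= mulr1; apply: H; apply: (ap_free_shift hA).
lra.
Qed.

Lemma sum_residues e L (F : nat -> nat) :
  \sum_(0 <= y < e * L) F y = \sum_(0 <= c < e) \sum_(0 <= i < L) F (c + e * i).
Proof.
rewrite exchange_big /=; elim: L => [|L IH]; first by rewrite muln0 !big_geq.
rewrite big_nat_recr //= -IH (@big_cat_nat _ _ _ (e * L)) //=; last by rewrite leq_mul.
by congr (_ + _); rewrite -{1}(add0n (e * L)) big_addn mulnS addnK.
Qed.

(** The residue classes modulo e reduce the claim to runs of consecutive
    integers. *)
Lemma runs_bound (R : realFieldType) (r : R) l0 :
  (forall A l, ap_free A -> ((count_in A 0 l)%:R <= r * l%:R + l0%:R)%R) ->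
  forall (A V : pred nat) e n, ap_free A -> (forall i, A i -> V i) ->
  (forall i, V i -> i < n) -> 0 < e ->
  ((count_in A 0 n)%:R <= r * (count_in V 0 n)%:R + l0%:R * (run_starts e V n)%:R)%R.
Proof.
move=> H A V e n hA AV Vn e0.
have cut (P : pred nat) : (forall i, P i -> V i) -> \sum_(0 <= y < n) P y = \sum_(0 <= y < e * n) P y.
  move=> PV; rewrite [RHS](@big_cat_nat _ _ _ n) //=; last by rewrite leq_pmull.
  rewrite [X in _ + X]big_nat_cond [X in _ + X]big1 ?addn0 // => y /andP[/andP[ny _] _].
  by apply/eqP; rewrite eqb0; apply/negP => /PV /Vn; rewrite ltnNge ny.
rewrite /count_in /run_starts !cut //; last by move=> i /andP[].
rewrite !sum_residues !natr_sum !mulr_sumr -big_split /= big_nat_cond [leRHS]big_nat_cond.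
apply: ler_sum => c /andP[/andP[_ ce] _].
have hA' : ap_free (fun i => A (c + e * i)) by apply: ap_free_affine.
have := @run_bound _ r l0 H _ (fun i => V (c + e * i)) hA' (fun i => @AV _) n 0.
rewrite addn0 => /(_ ltac:(by move=> i /andP[h1 h2]; move: (leq_trans h2 h1); rewrite ltnn)) h.
apply: le_trans h _; rewrite lerD2l ler_wpM2l // ler_nat.
apply: leq_sum => -[|i] _ /=; case: (V _) => //=; first by rewrite muln0 addn0 ce.
by rewrite subn1 /= mulnS addnCA addKn; case: (V _); rewrite ?orbT.
Qed.

(** * Roth's theorem *)

(** The points 2m - x, for m in s and x < h in A.  When s is a part of A beyond h,
    these complete progressions x, m, 2m - x, hence are missing from A. *)
Definition reflected (A : pred nat) h (s : seq nat) y :=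
  has (fun m => [&& y <= m.*2, m.*2 - y < h & A (m.*2 - y)]) s.

(** What translation by 2d adds to the reflected set.  Enlarging a cube by a
    difference d enlarges its reflected set by at least this much. *)
Definition reflected_new A h s d y :=
  [&& d.*2 <= y, reflected A h s (y - d.*2) & ~~ reflected A h s y].

Lemma reflected_cube A h a d ds y :
  reflected A h (cube a ds) y + reflected_new A h (cube a ds) d y <=
  reflected A h (cube a (d :: ds)) y.
Proof.
rewrite /reflected_new /= {4}/reflected has_cat -/(reflected _ _ _ _).
case: (reflected A h (cube a ds) y) => /=; rewrite ?andbF ?addn0 ?leq_b1 // add0n andbT.
case: (boolP (_ && _)) => // /andP[dy /hasP[m ms /and3P[h1 h2 h3]]] /=.
have -> // : has (fun m0 => [&& y <= m0.*2, m0.*2 - y < h & A (m0.*2 - y)]) (map (addn d) (cube a ds)).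
apply/hasP; exists (d + m); first exact: map_f.
have -> : (d + m).*2 - y = m.*2 - (y - d.*2) by rewrite doubleD subnBA // addnC.
by rewrite h2 h3 !andbT doubleD -leq_subLR.
Qed.

(** The reflected sets of a growing cube increase within [0, n), so among k steps
    one adds at most n / k points. *)
Lemma almost_invariant A h a k n ds :
  (exists d ds', [/\ d \in ds, {subset cube a ds' <= cube a ds} &
     count_in (reflected_new A h (cube a ds') d) 0 n * k <= n]) \/
  size ds * n.+1 <= k * count_in (reflected A h (cube a ds)) 0 n.
Proof.
elim: ds => [|d ds [[d' [ds' [dd sub inc]]]|IH]]; first by right.
  left; exists d', ds'; split=> //; first by rewrite in_cons dd orbT.
  by move=> x /sub xds; rewrite /= mem_cat xds.
have [inc|inc] := leqP (count_in (reflected_new A h (cube a ds) d) 0 n * k) n.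
  left; exists d, ds; split=> //; first by rewrite mem_head.
  by move=> x xds; rewrite /= mem_cat xds.
right; have step : count_in (reflected A h (cube a ds)) 0 n +
    count_in (reflected_new A h (cube a ds) d) 0 n <= count_in (reflected A h (cube a (d :: ds))) 0 n.
  by rewrite /count_in -big_split /=; apply: leq_sum => y _; apply: reflected_cube.
apply: (leq_trans _ (leq_mul (leqnn k) step)).
by rewrite mulnDr [size _ * _]mulSn addnC leq_add // mulnC.
Qed.

Lemma reflected_ge A h s b n : b \in s -> h <= b -> b.*2 < n ->
  count_in A 0 h <= count_in (reflected A h s) 0 n.
Proof.
move=> bs hb bn.
rewrite [leqRHS](@count_in_cat _ _ (b.*2.+1 - h)) //; last by lia.
apply: leq_trans (leq_addl _ _).
rewrite [leqRHS](@count_in_cat _ _ b.*2.+1) ?leq_subr //.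
apply: leq_trans (leq_addr _ _).
have E : b.*2.+1 = b.*2.+1 - h + h by lia.
rewrite {2}E count_in_shift /count_in big_nat_rev /= big_nat_cond [leqRHS]big_nat_cond.
apply: leq_sum => i /andP[/andP[_ ih] _].
case: (boolP (A _)) => //= Ai.
have -> // : reflected A h s (b.*2.+1 - h + i).
apply/hasP; exists b => //.
have -> : b.*2 - (b.*2.+1 - h + i) = 0 + h - i.+1 by lia.
by rewrite Ai; lia.
Qed.

Lemma reflected_disjoint A h s y : ap_free A -> {in s, forall m, A m && (h <= m)} ->
  reflected A h s y -> ~~ A y.
Proof.
move=> hA sA /hasP[m /sA /andP[Am hm] /and3P[ym xh Ax]]; apply/negP => Ay.
set x := m.*2 - y in xh Ax.
apply: (hA x (m - x)) => //; first by lia.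
- by rewrite subnKC //; lia.
- by have -> : x + (m - x).*2 = y by lia.
Qed.

(** A run of difference 2d outside the reflected set starts among the first 2d
    integers or just after a point of the reflected set, hence at a point which the
    translation adds. *)
Lemma run_starts_le A h s d n :
  run_starts d.*2 (fun y => (y < n) && ~~ reflected A h s y) n <=
  d.*2 + count_in (reflected_new A h s d) 0 n.
Proof.
apply: leq_trans (leq_add (sum_ltn_le d.*2 n) (leqnn _)).
rewrite /count_in -big_split /=; apply: leq_sum => y _.
rewrite /reflected_new; case: (ltnP y n) => //= yn.
case: (reflected A h s y) => //=; case: ltnP => //= dy.
have -> : y - d.*2 < n by lia.
by rewrite negbK andbT; case: (reflected _ _ _ _).
Qed.

(** c is the limiting density of the largest progression-free sets.  Take A of
    density almost c on [0, n), where n = 8 w.  It has density almost c on every long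
    interval, since no interval can compensate a loss elsewhere.  So [3w, 4w) contains
    a cube of A, and the points reflected in it form a set N, disjoint from A, of size
    at least 2 c w.  For one of the subcubes N is almost invariant under translation
    by some 2d, so its complement consists of long progressions, on which A still has
    density at most about c.  Then A has at most about c (n - |N|) points, too few. *)
Lemma no_critical_density (R : realType) (c : R) : (0 < c)%R -> (c <= 1)%R ->
  (forall (r : R) l, (r < c)%R -> 0 < l -> exists2 A, ap_free A & (r * l%:R < (count_in A 0 l)%:R)%R) ->
  (forall e : R, (0 < e)%R -> exists r l0, [/\ (0 <= r)%R, (r < c + e)%R, 0 < l0 &
     forall A, ap_free A -> ((count_in A 0 l0)%:R <= r * l0%:R)%R]) -> False.
Proof.
move=> c0 c1 low up.
(* The final gain is 2 c^2 w; e, k and w are chosen so that the errors, which are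
   16 e w, 8 l0 w / k and l0 (1 + 2 D), stay below it. *)
pose e : R := (c ^+ 2 / 64)%R.
have e0 : (0 < e)%R by rewrite divr_gt0 ?exprn_gt0.
have [r [l0 [r0 rc l00 H0]]] := up _ e0.
have H := density_all r0 l00 H0.
pose k := (Num.bound (16 * l0%:R / c ^+ 2)).+1.
have c20 : (0 < c ^+ 2)%R by rewrite exprn_gt0.
have kP : (16 * l0%:R <= c ^+ 2 * k%:R)%R.
  rewrite mulrC [leRHS]mulrC -ler_pdivrMr // mulrC; apply: ltW.
  apply: lt_trans (archi_boundP _) _; first by rewrite divr_ge0 ?mulr_ge0 // ltW.
  by rewrite ltr_nat.
have c8 : (0 < c / 8)%R by rewrite divr_gt0.
have [D [w0 Hc]] := cube_exists k c8.
pose w := (w0 + Num.bound (8 * l0%:R / c) + Num.bound (2 * (l0 * (1 + 2 * D))%:R / c ^+ 2)).+1.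
have w1 : (8 * l0%:R <= c * w%:R)%R.
  rewrite [leRHS]mulrC -ler_pdivrMr //; apply: ltW.
  apply: lt_trans (archi_boundP _) _; first by rewrite divr_ge0 ?mulr_ge0 // ltW.
  by rewrite ltr_nat /w ltnS -addnA addnCA leq_addr.
have w2 : (2 * (l0 * (1 + 2 * D))%:R <= c ^+ 2 * w%:R)%R.
  rewrite [leRHS]mulrC -ler_pdivrMr //; apply: ltW.
  apply: lt_trans (archi_boundP _) _; first by rewrite divr_ge0 ?mulr_ge0 // ltW.
  by rewrite ltr_nat /w ltnS leq_addl.
have w_gt0 : 0 < w by [].
have ww : w0 <= 4 * w.
  by apply: leq_trans (leq_pmull _ _) => //; rewrite /w leqW // -addnA leq_addr.
move: (w) w1 w2 w_gt0 ww => {}w w1 w2 w_gt0 ww.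
pose n := 8 * w; pose h := 3 * w.
have ce : (c - e < c)%R by rewrite ltrBlDr ltrDl.
have n_gt0 : 0 < n by rewrite muln_gt0.
have [A0 hA0 cA0] := low _ n ce n_gt0.
pose A := [pred x | A0 x && (x < n)].
have hA : ap_free A by apply: ap_free_sub hA0 => x /andP[].
have cA : ((c - e) * n%:R < (count_in A 0 n)%:R)%R.
  apply: lt_le_trans cA0 _; rewrite ler_nat /count_in big_nat_cond [leqRHS]big_nat_cond.
  by apply: leq_sum => x /andP[/andP[_ xn] _]; rewrite /= xn andbT.
have piece a l : ((count_in A a (a + l))%:R <= r * l%:R + l0%:R)%R.
  by rewrite count_in_shift; apply: H; apply: ap_free_shift.
have nE : (n%:R = 8 * w%:R :> R)%R by rewrite natrM.
have p1 : ((count_in A 0 h)%:R <= r * (3 * w%:R) + l0%:R)%R.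
  by have := piece 0 h; rewrite add0n natrM.
have p2 : ((count_in A (4 * w) n)%:R <= r * (4 * w%:R) + l0%:R)%R.
  have := piece (4 * w) (4 * w); rewrite natrM (_ : 4 * w + 4 * w = n) //; rewrite /n; clear; lia.
have cE : count_in A 0 n = count_in A 0 h + count_in A h (4 * w) + count_in A (4 * w) n.
  rewrite -!count_in_cat //; rewrite /n /h; clear; lia.
have p3 : ((count_in A h (4 * w))%:R <= r * w%:R + l0%:R)%R.
  have := piece h w; rewrite (_ : h + w = 4 * w) //; rewrite /h; clear; lia.
have w_ge0 : (0 <= w%:R :> R)%R by [].
have cc : (c ^+ 2 <= c)%R by rewrite expr2 ler_piMl // ltW.
have ew : (64 * (e * w%:R) <= c * w%:R)%R.
  by rewrite mulrA ler_wpM2r // /e mulrC divfK // pnatr_eq0.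
have rw : (r * w%:R <= c * w%:R + e * w%:R)%R by rewrite -mulrDl ler_wpM2r // ltW.
have rwE a : (r * (a * w%:R) = a * (r * w%:R))%R by rewrite mulrCA.
have cew : ((c - e) * n%:R = 8 * (c * w%:R) - 8 * (e * w%:R))%R by rewrite nE; ring.
rewrite cew cE !natrD in cA.
rewrite rwE in p1; rewrite rwE in p2.
(* The cube is sought in the part of A just after h, so that 2m < n for its points. *)
pose M := [pred x | A x && (h <= x < 4 * w)].
have cM : (c / 8 * (4 * w)%:R <= (count_in M 0 (4 * w))%:R)%R.
  have -> : count_in M 0 (4 * w) = count_in A h (4 * w).
    rewrite (@count_in_cat _ _ h) //; last by rewrite /h; clear; lia.
    rewrite [X in X + _]/count_in [X in X + _]big_nat_cond [X in X + _]big1 ?add0n.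
      rewrite /count_in big_nat_cond [RHS]big_nat_cond; apply: eq_bigr => x /andP[hx _].
      by rewrite /= hx andbT.
    by move=> x /andP[/andP[_ xh] _]; rewrite /= (leqNgt h) xh andbF.
  by rewrite natrM; move: cA p1 p2 p3 ew rw w1; clear; lra.
have Mlt x : M x -> x < 4 * w by case/andP => _ /andP[].
have [a [ds [sds allds cub]]] := Hc _ _ ww Mlt cM.
have [[d [ds' [dds sub inc]]]|] := almost_invariant A h a k n ds; last first.
  rewrite sds leqNgt => /negP; apply.
  rewrite ltn_pmul2l //; apply: leq_trans (count_in_le _ _ _) _; by rewrite subn0.
have /andP[d0 dD] := allP allds _ dds.
set s := cube a ds' in sub inc.
have sM m : m \in s -> M m by move=> /sub /(allP cub).
pose N := reflected A h s.
have bs : a \in s by apply: cube_base.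
have cN : count_in A 0 h <= count_in N 0 n.
  apply: (@reflected_ge A h s a n bs); have /andP[_ /andP[ha aw]] := sM _ bs => //.
  by rewrite /n; move: aw; clear; lia.
pose V y := (y < n) && ~~ N y.
have AV i : A i -> V i.
  move=> Ai; rewrite /V; case/andP: (Ai) => _ -> /=; apply: contraL Ai => Ni.
  by apply: (reflected_disjoint hA _ Ni) => m /sM /andP[-> /andP[->]].
have d20 : 0 < d.*2 by rewrite double_gt0.
have Vn i : V i -> i < n by case/andP.
have := runs_bound H hA AV Vn d20.
have := run_starts_le A h s d n; rewrite -/N -/V.
set st := run_starts _ _ _; set nw := count_in _ 0 n in inc * => hst.
have VN : count_in V 0 n + count_in N 0 n = n.
  rewrite /count_in -big_split /= -[RHS](subn0 n) -[RHS]muln1 -sum_nat_const_nat.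
  rewrite big_nat_cond [RHS]big_nat_cond; apply: eq_bigr => y /andP[/andP[_ yn] _].
  by rewrite /V yn /=; case: (N y).
rewrite cE !natrD => final.
have cNR : ((count_in A 0 h)%:R <= (count_in N 0 n)%:R :> R)%R by rewrite ler_nat.
have VNR : ((count_in V 0 n)%:R + (count_in N 0 n)%:R = 8 * w%:R :> R)%R by rewrite -natrD VN nE.
have incR : (nw%:R * k%:R <= 8 * w%:R :> R)%R by rewrite -natrM -nE ler_nat.
have stR : (st%:R <= 2 * D%:R + nw%:R :> R)%R.
  rewrite -natrM -natrD ler_nat; apply: leq_trans hst _; rewrite leq_add2r -muln2 mulnC leq_mul2l dD orbT //.
have l0R : (0 < l0%:R :> R)%R by rewrite ltr0n.
have cr : (c <= r)%R.
  rewrite leNgt; apply/negP => rltc; have [B hB] := low r l0 rltc l00.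
  by rewrite ltNge H0.
set a0 := ((count_in A 0 h)%:R)%R in cNR final cA p1.
set NR := ((count_in N 0 n)%:R)%R in cNR VNR; set VR := ((count_in V 0 n)%:R)%R in VNR final.
have N2 : (2 * (c * w%:R) <= NR)%R by move: ew rw w1 cA p2 p3 cNR l0R; clear; lra.
have rN : (2 * (c ^+ 2 * w%:R) <= r * NR)%R.
  apply: (@le_trans _ _ (c * NR))%R; last by rewrite ler_wpM2r.
  by rewrite expr2 -mulrA mulrCA ler_wpM2l // ltW.
have rV : (r * VR = 8 * (r * w%:R) - r * NR)%R.
  have -> : (VR = 8 * w%:R - NR)%R by move: VNR; clear; lra.
  by rewrite mulrBr rwE.
have e1 : (64 * (e * w%:R) = c ^+ 2 * w%:R)%R.
  by rewrite mulrA; congr (_ * _)%R; rewrite /e mulrC divfK // pnatr_eq0.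
have l1 : (l0%:R * st%:R <= l0%:R * (2 * D%:R) + l0%:R * nw%:R :> R)%R by rewrite -mulrDr ler_wpM2l // ltW.
have l2 : (2 * (l0%:R * (2 * D%:R)) <= c ^+ 2 * w%:R)%R.
  by apply: le_trans w2; rewrite -!natrM ler_nat !leq_mul2l leq_addl !orbT.
have l3 : (16 * (l0%:R * nw%:R) <= 8 * (c ^+ 2 * w%:R))%R.
  rewrite mulrA; apply: (@le_trans _ _ (c ^+ 2 * k%:R * nw%:R))%R; first by rewrite ler_wpM2r.
  by rewrite -mulrA (mulrC k%:R%R) [leRHS]mulrCA ler_wpM2l // ltW.
have c2w : (0 < c ^+ 2 * w%:R)%R by rewrite mulr_gt0 // ltr0n.
by move: final cA rw rN e1 l1 l2 l3 c2w; rewrite rV; clear; lra.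
Qed.

Theorem roth (R : realType) (delta : R) : (0 < delta)%R ->
  exists T, forall X (A : pred nat), T <= X ->
    (delta * X%:R <= (count_in A 1 X.+1)%:R)%R -> ~ ap_free A.
Proof.
move=> delta0.
(* The densities that no progression-free set exceeds on some fixed length. *)
pose E : set R := [set r | (0 <= r)%R /\ exists2 l0, 0 < l0 &
   forall A, ap_free A -> ((count_in A 0 l0)%:R <= r * l0%:R)%R]%classic.
have E1 : E 1%R.
  split=> //; exists 1 => // A _; rewrite mul1r ler_nat.
  exact: leq_trans (count_in_le _ _ _) _.
have Elb : lbound E 0%R by move=> r [].
have Einf : has_inf E by split; [exists 1%R | exists 0%R].
have c_ge0 : (0 <= inf E)%R by apply: lb_le_inf => //; exists 1%R.
have c_le1 : (inf E <= 1)%R by apply: ge_inf => //; exists 0%R.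
have up (e : R) : (0 < e)%R -> exists r l0, [/\ (0 <= r)%R, (r < inf E + e)%R, 0 < l0 &
     forall A, ap_free A -> ((count_in A 0 l0)%:R <= r * l0%:R)%R].
  by move=> e0; have [r [r0 [l0 l00 H]] re] := inf_adherent e0 Einf; exists r, l0.
have c0 : inf E = 0%R.
  apply/eqP; rewrite eq_le c_ge0 andbT leNgt; apply/negP => c_gt0.
  apply: (no_critical_density c_gt0 c_le1 _ up) => r l rc l0.
  have [r0|r0] := leP 0%R r; last first.
    exists pred0 => //; apply: (@lt_le_trans _ _ 0%R) => //.
    by rewrite nmulr_rlt0 // ltr0n.
  have [[A [hA cA]]|none] := pselect (exists A, ap_free A /\ (r * l%:R < (count_in A 0 l)%:R)%R).
    by exists A.
  have : E r.
    split=> //; exists l => // A hA; rewrite leNgt; apply/negP => cA.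
    by apply: none; exists A.
  by move=> /(ge_inf (ex_intro _ 0%R Elb)); rewrite leNgt rc.
have d2 : (0 < delta / 2)%R by rewrite divr_gt0.
have [r [l0 [r0 rd l00 H0]]] := up _ d2; rewrite c0 add0r in rd.
exists (Num.bound (2 * l0%:R / delta)).+1 => X A TX cA hA.
have X0 : 0 < X by apply: leq_trans TX.
have big : (2 * l0%:R < delta * X%:R)%R.
  rewrite mulrC [ltRHS]mulrC -ltr_pdivrMr // mulrC.
  apply: lt_le_trans (archi_boundP _) _; first by rewrite divr_ge0 ?mulr_ge0 // ltW.
  by rewrite ler_nat; apply: ltnW.
have := density_all r0 l00 H0 X (ap_free_shift (b := 1) hA).
rewrite -count_in_shift add1n => h.
have : (r * X%:R <= delta / 2 * X%:R)%R by rewrite ler_wpM2r // ltW.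
by move: h cA big; clear; lra.
Qed.

(** * Smooth numbers up to a power of the smoothness bound *)

Lemma sievedT y x : x <= y -> count_sieved 0 y x = x.
Proof.
move=> xy; rewrite /count_sieved big_nat_cond (eq_bigr (fun=> 1)).
  by rewrite -big_nat_cond sum_nat_const_nat subn1 muln1.
move=> n /andP[/andP[n0 nx] _]; have -> // : sieved 0 y n.
apply/sievedP; split=> // p pp pn; rewrite prime_gt0 //=.
by apply: leq_trans (dvdn_leq n0 pn) (leq_trans _ xy).
Qed.

(** Multiply smooth numbers up to x / p by primes p between sqrt y and y.
    Their harmonic sum is bounded below, and a number up to y^((k + 1) / 2) is reached
    boundedly often. *)
Lemma smooth_density_step (R : realFieldType) k c : 0 < c ->
  (forall y x, 64 <= lg y -> x ^ 2 <= y ^ k -> x <= c * count_sieved 0 y x) ->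
  forall y x, 64 <= lg y -> x ^ 2 <= y ^ k.+1 ->
    x <= 32768 * (2 * k + 3) * c * count_sieved 0 y x.
Proof.
move=> c0 IH y x y64 xy.
have y0 : 0 < y by case: (y) y64; rewrite ?trunc_log0.
have [xley|yltx] := leqP x y.
  by rewrite sievedT //; apply: leq_pmull; rewrite !muln_gt0 c0 addn_gt0 orbT.
(* The window of primes from y / 256^(2a) to y / 256^a lies above sqrt y. *)
pose a := lg y %/ 32.
have a0 : 0 < a by rewrite divn_gt0 //; lia.
have a1 : 32 * a <= lg y by rewrite mulnC leq_trunc_div.
have a2 : lg y <= 64 * a by have := ltn_ceil (lg y) (isT : 0 < 32); rewrite -/a; lia.
pose W := [pred p | prime_in 0 y p && ((y < p * (256 ^ a) ^ 2) && (p * 256 ^ a <= y))].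
have s4 : (256 ^ a) ^ 4 <= y.
  rewrite -expnM (_ : 256 ^ _ = 2 ^ (8 * (a * 4))); last by rewrite [RHS]expnM.
  by apply: leq_trans (lg_le y0); rewrite leq_exp2l //; lia.
have Wy p : W p -> prime p /\ y <= p ^ 2.
  move=> /andP[/andP[pp _] /andP[yps _]]; split=> //.
  rewrite -(leq_pmul2r y0); apply: (@leq_trans (p ^ 2 * (256 ^ a) ^ 4)).
    rewrite (expnM _ 2 2) -expnMn mulnn leq_exp2r //; exact: ltnW.
  by rewrite leq_mul2l s4 orbT.
have Wz p : W p -> prime_in 0 y p by case/andP.
have upper : \sum_(0 <= p < y.+1 | W p) count_sieved 0 y (x %/ p) <=
    (2 * k + 3) * count_sieved 0 y x.
  rewrite (eq_bigr (fun p => 1 * count_sieved 0 y (x %/ p))) => [|p _]; last by rewrite mul1n.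
  rewrite -double_count_sieved // /count_sieved big_distrr /= big_nat_cond [leqRHS]big_nat_cond.
  apply: leq_sum => n /andP[/andP[n0 nx] _]; rewrite mulnC leq_mul2r; apply/orP; right.
  have := omega_large n0 Wy; rewrite /omega; set o := \sum_(_ <= _ < _ | _) _ => ho.
  have lnx : lg n <= lg x by apply: leq_trunc_log.
  have : lg x + lg x < (lg y).+1 * k.+1.
    rewrite -(ltn_exp2l (m := 2)) // expnM expnD.
    apply: (@leq_ltn_trans (x ^ 2)).
      by rewrite -mulnn leq_mul // lg_le //; lia.
    by apply: leq_ltn_trans xy _; rewrite ltn_exp2r // lg_gt.
  have : o < (2 * k + 4) -> o <= 2 * k + 3 by lia.
  move=> fin h; apply: fin.
  rewrite -(ltn_pmul2r (_ : 0 < lg y)); last by lia.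
  apply: leq_ltn_trans ho _; move: h lnx y64; clear; nia.
have lower : (x%:R <= 32768%:R * (\sum_(0 <= p < y.+1 | W p) x %/ p)%:R :> R)%R.
  have hS : (1 <= 16384%:R * harmonic R W y)%R.
    have := harmonic_window_ge R (z := 0) a0 (leq0n a) a1; rewrite -/W => h.
    have l0 : (0 < (lg y)%:R :> R)%R by rewrite ltr0n; lia.
    have la : ((lg y)%:R <= 64%:R * a%:R :> R)%R by rewrite -natrM ler_nat.
    rewrite -(ler_pM2l l0) mulr1; apply: le_trans la _.
    apply: (@le_trans _ _ (64%:R * (256 * (lg y)%:R * harmonic R W y))%R).
      by rewrite ler_wpM2l.
    have -> : (16384%:R = 64%:R * 256%:R :> R)%R by rewrite -natrM.
    by rewrite le_eqVlt; apply/orP; left; apply/eqP; ring.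
  apply: (@le_trans _ _ (x%:R * (16384%:R * harmonic R W y))%R).
    by rewrite ler_peMr.
  have -> : (32768%:R = 2%:R * 16384%:R :> R)%R by rewrite -natrM.
  rewrite mulrCA -[leRHS]mulrA [leRHS]mulrCA ler_wpM2l // natr_sum /harmonic !mulr_sumr.
  apply: ler_sum => p Wp; have [/andP[pp /andP[_ py]] _] := (Wz _ Wp, tt).
  have p0 := prime_gt0 pp.
  rewrite ler_pdivrMr ?ltr0n // -!natrM ler_nat.
  have := ltn_ceil x p0; have : 0 < x %/ p by rewrite divn_gt0 // (leq_trans py) // ltnW.
  set q := x %/ p; clear; nia.
have rec p : W p -> x %/ p <= c * count_sieved 0 y (x %/ p).
  move=> Wp; apply: IH => //; have [pp yp] := Wy _ Wp.
  rewrite -(leq_pmul2r y0) -expnSr; apply: leq_trans xy.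
  apply: (@leq_trans ((x %/ p) ^ 2 * p ^ 2)); first by rewrite leq_mul2l yp orbT.
  by rewrite -expnMn leq_exp2r // leq_trunc_div.
have sum_le : \sum_(0 <= p < y.+1 | W p) x %/ p <= c * ((2 * k + 3) * count_sieved 0 y x).
  apply: leq_trans (leq_mul (leqnn c) upper).
  by rewrite big_distrr /=; apply: leq_sum => p; apply: rec.
move: lower; rewrite -natrM ler_nat => lower; apply: (leq_trans lower).
rewrite -!mulnA leq_mul2l; apply/orP; right; apply: leq_trans sum_le _.
by rewrite mulnCA.
Qed.

Lemma smooth_density k : exists2 c, 0 < c & forall y x, 64 <= lg y -> x ^ 2 <= y ^ k ->
  x <= c * count_sieved 0 y x.
Proof.
elim: k => [|k [c c0 IH]].
  exists 1 => // y x y64 x1; rewrite mul1n sievedT //.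
  have y0 : 0 < y by case: (y) y64; rewrite ?trunc_log0.
  by apply: leq_trans y0; rewrite -(leq_exp2r _ _ (isT : 0 < 2)).
exists (32768 * (2 * k + 3) * c); first by rewrite !muln_gt0 c0 addn_gt0 orbT.
exact: (smooth_density_step rat c0 IH).
Qed.

(** * Fibres over the rough part *)

Definition small_primes z : nat_pred := [pred p | p <= z].

Lemma sieved_low z j : sieved 0 z j = (small_primes z).-nat j.
Proof.
apply/sievedP/andP => -[j0 H]; split=> //.
  apply/allP => p; rewrite mem_primes => /and3P[pp _ pj].
  by have /andP[] := H p pp pj.
move=> p pp pj; rewrite prime_gt0 //=.
by apply: (allP H p); rewrite mem_primes pp j0.
Qed.

Lemma sieved_high z y m : sieved z y m = sieved 0 y m && (small_primes z)^'.-nat m.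
Proof.
apply/sievedP/andP => [[m0 H]|[/sievedP[m0 H1] /andP[_ /allP H2]]].
  split; first by apply/sievedP; split=> // p pp /(H p pp) /andP[_ ->]; rewrite prime_gt0.
  apply/andP; split=> //; apply/allP => p; rewrite mem_primes => /and3P[pp _ pm].
  by have /andP[zp _] := H p pp pm; rewrite !inE -ltnNge.
split=> // p pp pm; have /andP[_ ->] := H1 p pp pm.
have := H2 p; rewrite mem_primes pp m0 pm => /(_ isT).
by rewrite !inE -ltnNge => ->.
Qed.

Lemma rough_divisor z y n : sieved 0 y n -> exists m, [/\ m %| n,
  sieved z y m && sieved 0 z (n %/ m) &
  forall m', m' %| n -> sieved z y m' && sieved 0 z (n %/ m') -> m' = m].
Proof.
move=> sn; have n0 := sieved_gt0 sn; have := partnC (small_primes z) n0.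
have := part_pnat (small_primes z) n; have := part_pnat (small_primes z)^' n.
move: (partn n _) (dvdn_part (small_primes z)^' n) => m mn.
move: (partn n _) => j pm pj nE; rewrite mulnC in nE.
have m0 : 0 < m by apply: dvdn_gt0 mn.
exists m; split=> // [|m' m'n /andP[sm' sj']].
  by rewrite sieved_high (sieved_dvd mn sn) pm -nE mulKn // sieved_low.
have nE' : n = m' * (n %/ m') by rewrite mulnC divnK.
have [pm' pj'] : (small_primes z)^'.-nat m' /\ (small_primes z).-nat (n %/ m').
  by move: sm' sj'; rewrite sieved_high (sieved_low z) => /andP[_ ->] ->.
have split_eq a b : (small_primes z)^'.-nat a -> (small_primes z).-nat b ->
    partn (a * b) (small_primes z)^' = a.
  move=> pa pb; rewrite partnM ; [|by case/andP: pa|by case/andP: pb].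
  by rewrite part_pnat_id // part_p'nat ?pnatNK // muln1.
by rewrite -(split_eq _ _ pm' pj') -nE' -nE split_eq.
Qed.

Lemma rough_divisor_unique z y n : z <= y -> 0 < n ->
  \sum_(1 <= m < n.+1) (m %| n) * (sieved z y m && sieved 0 z (n %/ m)) = sieved 0 y n.
Proof.
move=> zy n0.
have wide (j : nat) : sieved 0 z j -> sieved 0 y j.
  move=> /sievedP[j0 H]; apply/sievedP; split=> // p pp /(H p pp) /andP[-> pz].
  exact: leq_trans zy.
case: (boolP (sieved 0 y n)) => sn.
  have [m [mn sm uniq]] := rough_divisor z sn.
  have m0 : 0 < m by apply: dvdn_gt0 mn.
  have mI : m \in index_iota 1 n.+1 by rewrite mem_index_iota m0 ltnS dvdn_leq.
  rewrite (bigD1_seq m mI (iota_uniq _ _)) /= mn sm mul1n -[RHS]addn0; congr (_ + _).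
  rewrite big1_seq // => m' /andP[mm' _]; apply/eqP; rewrite muln_eq0 !eqb0.
  apply/orP; case: (boolP (m' %| n)) => dm /=; [right|by left].
  by apply: contra mm' => sm'; apply/eqP; apply: uniq.
rewrite big1 // => m _; apply/eqP; rewrite muln_eq0 !eqb0.
apply/orP; case: (boolP (m %| n)) => dm /=; [right|by left].
apply: contra sn => /andP[s1 s2]; rewrite -(divnK dm) sievedM wide //=.
by move: s1; rewrite sieved_high => /andP[].
Qed.

Lemma fibre_sum z y x (F : nat -> nat) : z <= y ->
  \sum_(1 <= n < x.+1) sieved 0 y n * F n =
  \sum_(1 <= m < x.+1) sieved z y m *
     \sum_(1 <= j < (x %/ m).+1) sieved 0 z j * F (m * j).
Proof.
move=> zy.
transitivity (\sum_(1 <= m < x.+1) \sum_(1 <= n < x.+1)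
   (m %| n) * ((sieved z y m && sieved 0 z (n %/ m)) * F n)).
  rewrite exchange_big /= big_nat_cond [RHS]big_nat_cond.
  apply: eq_bigr => n /andP[/andP[n0 nx] _].
  rewrite -(rough_divisor_unique zy n0) big_distrl /=.
  rewrite [RHS](@big_cat_nat _ _ _ n.+1) //= [X in _ = _ + X]big_nat_cond.
  rewrite [X in _ = _ + X]big1 ?addn0; last first.
    move=> m /andP[/andP[nm _] _]; rewrite [m %| n](_ : _ = false) ?mul0n //.
    by apply/negP => /(dvdn_leq n0); rewrite leqNgt nm.
  by apply: eq_bigr => m _; rewrite mulnA.
rewrite big_nat_cond [RHS]big_nat_cond; apply: eq_bigr => m /andP[/andP[m0 _] _].
rewrite (sum_multiples _ (fun n => (sieved z y m && sieved 0 z (n %/ m)) * F n)) //.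
rewrite big_distrr /=; apply: eq_bigr => j _; rewrite mulKn //.
by case: (sieved z y m); rewrite ?mul0n ?mul1n.
Qed.

Lemma fibre_count z y x : z <= y ->
  count_sieved 0 y x = \sum_(1 <= m < x.+1) sieved z y m * count_sieved 0 z (x %/ m).
Proof.
move=> zy; have := fibre_sum x (fun=> 1) zy.
rewrite /count_sieved; under eq_bigr do rewrite muln1.
by move=> ->; apply: eq_bigr => m _; congr (_ * _); apply: eq_bigr => j _; rewrite muln1.
Qed.

Lemma fibre_count_sym z y x : z <= y ->
  count_sieved 0 y x = \sum_(1 <= j < x.+1) sieved 0 z j * count_sieved z y (x %/ j).
Proof.
move=> zy; rewrite (fibre_count x zy).
transitivity (\sum_(1 <= m < x.+1) \sum_(1 <= j < x.+1)
   sieved z y m * (sieved 0 z j * (m * j <= x))).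
  rewrite big_nat_cond [RHS]big_nat_cond; apply: eq_bigr => m /andP[/andP[m0 _] _].
  rewrite -big_distrr /=; congr (_ * _).
  rewrite (@count_sieved_sum _ _ _ x) ?leq_div //; apply: eq_bigr => j _.
  by congr (_ * nat_of_bool _); rewrite leq_divRL // mulnC.
rewrite exchange_big /= big_nat_cond [RHS]big_nat_cond.
apply: eq_bigr => j /andP[/andP[j0 _] _].
rewrite (@count_sieved_sum _ _ _ x) ?leq_div // big_distrr /=; apply: eq_bigr => m _.
by rewrite leq_divRL // mulnCA.
Qed.

(** The numbers j <= z are z-smooth, and the fibres over them have sizes
    N(x / j), at least a constant times N(x) / j; the harmonic sum over j is of order
    log z. *)
Lemma rough_sparse z : 0 < z -> exists y0, forall y x, y0 <= y -> lg x ^ 8 <= y ->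
  24 * lg y <= lg x -> z <= y ->
  lg z * count_sieved z y x <= 2000 * count_sieved 0 y x.
Proof.
move=> z0; have [y0 H] := count_sieved_div_lower z z.
exists (y0 + 2) => y x yy Ly yL zy.
have zx : z <= x.
  apply: leq_trans zy _; case: (posnP x) => [x0|x0].
    by move: yL; rewrite x0 trunc_log0; have : 0 < lg y by [rewrite trunc_log_gt0 /=; lia]; lia.
  rewrite leqNgt; apply/negP => xy; have := leq_trunc_log 2 (ltnW xy).
  by have : 0 < lg y by [rewrite trunc_log_gt0 /=; lia]; lia.
have dyadic k : 2 ^ k <= z -> k * count_sieved z y x <=
    2000 * \sum_(1 <= j < 2 ^ k) count_sieved z y (x %/ j).
  elim: k => [|k IH] kz; first by rewrite mul0n.
  have kz' : 2 ^ k <= z by apply: leq_trans kz; rewrite leq_exp2l.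
  have {}IH := IH kz'.
  rewrite (@big_cat_nat _ _ _ (2 ^ k)) ?expn_gt0 ?leq_exp2l //= mulnDr mulSn addnC leq_add //.
  apply: (@leq_trans (2000 * \sum_(2 ^ k <= j < 2 ^ k.+1) count_sieved z y (x %/ 2 ^ k.+1))).
    rewrite sum_nat_const_nat expnS mul2n -addnn addnK addnn -mul2n -expnS.
    apply: (leq_trans (H y x (2 ^ k.+1) _ Ly yL _)); first lia.
      by rewrite expn_gt0.
    by rewrite expnS; apply/eq_leq; ring.
  rewrite leq_mul2l; apply/orP; right.
  rewrite big_nat_cond [leqRHS]big_nat_cond; apply: leq_sum => j /andP[/andP[j1 j2] _].
  apply: count_sieved_mono; rewrite leq_div2l // ?(ltnW j2) //.
  by apply: leq_trans j1; rewrite expn_gt0.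
apply: (leq_trans (dyadic _ (lg_le z0))); rewrite leq_mul2l; apply/orP; right.
rewrite (fibre_count_sym x zy) [leqRHS](@big_cat_nat _ _ _ (2 ^ lg z)) ?expn_gt0 //=; last first.
  by apply: leq_trans (lg_le z0) _; apply: leqW.
apply: leq_trans (leq_addr _ _).
rewrite big_nat_cond [leqRHS]big_nat_cond; apply: leq_sum => j /andP[/andP[j1 j2] _].
have -> : sieved 0 z j; last by rewrite mul1n.
apply/sievedP; split=> // p pp pj; rewrite prime_gt0 //=.
apply: leq_trans (dvdn_leq j1 pj) _; apply: leq_trans (ltnW j2) (lg_le z0).
Qed.

(** * Short and long fibres *)

(** The upper growth bound makes p | n about as likely as for arbitrary
    integers, and the sum of log p / p over p <= z is O(log z), by Chebyshev on dyadic
    ranges. *)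
Lemma small_prime_weight z y x :
  z <= y -> 64 <= lg z ->
  (forall q, 0 < q <= z ^ 4 ->
     q * count_sieved 0 y (x %/ q) <= 1000 * count_sieved 0 y x) ->
  \sum_(1 <= n < x.+1) sieved 0 y n * weight 0 z n <=
  8000 * (lg z).+1 * count_sieved 0 y x.
Proof.
move=> zy z64 up; have z0 : 0 < z by case: (z) z64; rewrite ?trunc_log0.
rewrite (@double_count_sieved 0 y (prime_in 0 z) lg); last first.
  by move=> p /andP[pp /andP[p0 pz]]; rewrite /prime_in pp p0 (leq_trans pz).
have dyadic k : k <= (lg z).+1 ->
   \sum_(0 <= p < 2 ^ k | prime p) lg p * count_sieved 0 y (x %/ p) <=
   8000 * k * count_sieved 0 y x.
  elim: k => [|k IH] kz; first by rewrite big_mkcond big_nat_recr //= big_geq.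
  rewrite (@big_cat_nat _ _ _ (2 ^ k)) ?leq_exp2l //= mulnSr mulnDl leq_add ?IH ?(ltnW kz) //.
  apply: (@leq_trans (\sum_(2 ^ k <= p < 2 ^ k.+1 | prime p) lg p * count_sieved 0 y (x %/ 2 ^ k))).
    rewrite big_nat_cond [leqRHS]big_nat_cond; apply: leq_sum => p /andP[/andP[p1 p2] pp].
    by rewrite leq_mul2l count_sieved_mono ?orbT // leq_div2l // expn_gt0.
  rewrite -big_distrl /=.
  have th : \sum_(2 ^ k <= p < 2 ^ k.+1 | prime p) lg p <= 8 * 2 ^ k.
    apply: (@leq_trans (theta (2 ^ k.+1))); last by apply: leq_trans (theta_le _) _; rewrite expnS mulnA.
    rewrite /theta [leqRHS](@big_cat_nat _ _ _ (2 ^ k)) //=; last by rewrite leqW // leq_exp2l.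
    apply: leq_trans (leq_addl _ _).
    rewrite [leqRHS](@big_cat_nat _ _ _ (2 ^ k.+1)) ?leq_exp2l //=; exact: leq_addr.
  apply: leq_trans (leq_mul th (leqnn _)) _.
  have -> : 8000 * count_sieved 0 y x = 8 * (1000 * count_sieved 0 y x) by ring.
  rewrite -mulnA leq_mul2l /=; apply: up.
  rewrite expn_gt0 /=; apply: leq_trans (_ : z <= _).
    by apply: leq_trans (lg_le z0); rewrite leq_exp2l.
  by rewrite -{1}(expn1 z) leq_pexp2l.
apply: leq_trans (dyadic _ (leqnn _)).
by apply: leq_sum_range => p pz /andP[-> _]; rewrite andbT (leq_trans pz) // lg_gt.
Qed.

(** Only squares between z^4 and z^6 are considered, so that the growth bound is
    needed for bounded q only; [light_cases] reduces larger squares to these. *)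
Lemma square_tail z y x :
  0 < z ->
  (forall q, 0 < q <= z ^ 4 ->
     q * count_sieved 0 y (x %/ q) <= 1000 * count_sieved 0 y x) ->
  z * (\sum_(1 <= n < x.+1) sieved 0 y n *
         \sum_((z ^ 2).+1 <= d < (z ^ 3).+1) (d ^ 2 %| n)) <= 1000 * count_sieved 0 y x.
Proof.
move=> z0 up.
apply: (@leq_trans (z * (z ^ 3 * count_sieved 0 y (x %/ z ^ 4)))); last first.
  by rewrite mulnA -expnS; apply: up; rewrite expn_gt0 z0 leqnn.
rewrite leq_mul2l; apply/orP; right.
apply: (@leq_trans (\sum_((z ^ 2).+1 <= d < (z ^ 3).+1) count_sieved 0 y (x %/ z ^ 4))); last first.
  by rewrite sum_nat_const_nat leq_mul2r subSS leq_subr orbT.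
under eq_bigr do rewrite big_distrr /=.
rewrite exchange_big /= big_nat_cond [leqRHS]big_nat_cond.
apply: leq_sum => d /andP[/andP[yd _] _].
have d2 : 0 < d ^ 2 by rewrite expn_gt0 (leq_ltn_trans _ yd).
under eq_bigr do rewrite mulnC.
rewrite (sum_multiples _ (fun n => sieved 0 y n : nat)) //.
apply: (@leq_trans (count_sieved 0 y (x %/ d ^ 2))).
  by apply: leq_sum => m _; rewrite sievedM; case: (sieved 0 y m); rewrite ?andbF ?leq_b1.
apply: count_sieved_mono; apply: leq_div2l; first by rewrite expn_gt0 z0.
by rewrite (expnM z 2 2) leq_exp2r // ltnW.
Qed.

(** If x / m > z^U, then n = m j satisfies n <= x / z or j > z^(U - 1).  In the
    second case j has weight at least a quarter of U log z, which is rare by Markov's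
    inequality, or it is divisible by a large square. *)
Lemma long_fibres z y x U :
  z <= y -> 64 <= lg z ->
  (forall q, 0 < q <= z ^ 4 ->
     q * count_sieved 0 y (x %/ q) <= 1000 * count_sieved 0 y x) ->
  24 <= U ->
  U * z * (\sum_(1 <= m < x.+1) sieved z y m *
       ((z ^ U < x %/ m) * count_sieved 0 z (x %/ m))) <=
  (64000 * z + 2000 * U) * count_sieved 0 y x.
Proof.
move=> zy z64 up U24; have z0 : 0 < z by case: (z) z64; rewrite ?trunc_log0.
set N := count_sieved 0 y x; pose L := U * lg z.
(* F n bounds the indicator of the three exceptional cases for n = m j. *)
pose F n := (n <= x %/ z) + ((L <= 4 * weight 0 z n) +
   \sum_((z ^ 2).+1 <= d < (z ^ 3).+1) (d ^ 2 %| n)).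
have zL : 2 ^ L <= z ^ U by rewrite /L mulnC expnM leq_exp2r ?lg_le //; lia.
have L24 : 24 * lg z <= L by rewrite leq_mul2r U24 orbT.
have lz0 : 0 < lg z by lia.
have long : \sum_(1 <= m < x.+1) sieved z y m *
       ((z ^ U < x %/ m) * count_sieved 0 z (x %/ m)) <=
    \sum_(1 <= n < x.+1) sieved 0 y n * F n.
  rewrite (fibre_sum _ _ zy) big_nat_cond [leqRHS]big_nat_cond.
  apply: leq_sum => m /andP[/andP[m0 mx] _]; rewrite leq_mul2l; apply/orP; right.
  case: ltnP => // zm; rewrite mul1n; apply: leq_sum => j _.
  case: (boolP (sieved 0 z j)) => //= sj; rewrite mul1n.
  have j0 := sieved_gt0 sj.
  rewrite /F; case: (leqP (m * j) (x %/ z)) => // big.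
  apply: leq_trans (leq_addl _ _).
  have xj : x %/ m < j * z.
    have -> : (x %/ m < j * z) = (x < m * j * z) by rewrite ltn_divLR // mulnC mulnA.
    by rewrite -ltn_divLR.
  have heavy : ~~ (j * z ^ 2 < 2 ^ L).
    rewrite -leqNgt; apply: leq_trans zL _; apply: leq_trans (ltnW zm) _.
    apply: leq_trans (ltnW xj) _; rewrite leq_mul2l -{1}(expn1 z) leq_pexp2l ?orbT //.
  case: (ltnP (4 * weight 0 z j) L) => wj.
    have [h|[d dz dj]] := light_cases sj L24 lz0 wj; first by rewrite h in heavy.
    apply: leq_trans (leq_addl _ _).
    have dI : d \in index_iota (z ^ 2).+1 (z ^ 3).+1 by rewrite mem_index_iota ltnS.
    by rewrite (bigD1_seq d dI (iota_uniq _ _)) /= dvdn_mull.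
  have -> // : L <= 4 * weight 0 z (m * j).
  apply: leq_trans wj _; rewrite leq_mul2l; apply/orP; right.
  by apply: leq_sum_pred => p /andP[-> pj]; rewrite dvdn_mull.
apply: leq_trans (leq_mul (leqnn _) long) _.
under eq_bigr do rewrite mulnDr mulnDr.
rewrite !big_split /= -count_sieved_sum ?leq_div //.
set S2 := \sum_(_ <= _ < _) sieved 0 y _ * (L <= _).
have := square_tail z0 up; set S3 := \sum_(_ <= _ < _) _ => h3.
have h1 : z * count_sieved 0 y (x %/ z) <= 1000 * N.
  by apply: up; rewrite z0 -{1}(expn1 z) leq_pexp2l.
have h2 : U * S2 <= 64000 * N.
  have lS : L * S2 <= 4 * (8000 * (lg z).+1 * N).
    apply: leq_trans (leq_mul (leqnn 4) (small_prime_weight zy z64 up)).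
    rewrite !big_distrr /=; apply: leq_sum => n _.
    by case: (sieved 0 y n); rewrite ?mul0n ?muln0 // !mul1n; case: (leqP L (4 * weight 0 z n)); rewrite ?muln0 ?muln1.
  rewrite -(leq_pmul2l lz0); apply: (@leq_trans (L * S2)); first by apply/eq_leq; rewrite /L; ring.
  apply: leq_trans lS _.
  have l2 : (lg z).+1 <= 2 * lg z by move: lz0; clear; lia.
  apply: (@leq_trans (4 * (8000 * (2 * lg z) * N))); first by rewrite !leq_mul2l leq_mul2r leq_mul2l l2 !orbT.
  by apply/eq_leq; ring.
have -> : U * z * (count_sieved 0 y (x %/ z) + (S2 + S3)) =
  U * (z * count_sieved 0 y (x %/ z)) + z * (U * S2) + U * (z * S3) by ring.
have -> : (64000 * z + 2000 * U) * N = U * (1000 * N) + z * (64000 * N) + U * (1000 * N) by ring.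
by rewrite !leq_add // leq_mul2l ?h1 ?h2 ?h3 orbT.
Qed.

(** * Dense sets of smooth natural numbers *)

Lemma roth_nat (R : realType) c : 0 < c ->
  exists T, forall X (A : pred nat), T <= X -> X <= c * count_in A 1 X.+1 -> ~ ap_free A.
Proof.
move=> c0; have d0 : (0 < c%:R^-1 :> R)%R by rewrite invr_gt0 ltr0n.
have [T H] := roth d0; exists T => X A TX XA; apply: H TX _.
by rewrite ler_pdivrMl ?ltr0n // -natrM ler_nat.
Qed.

Lemma short_fibres z y x T :
  \sum_(1 <= m < x.+1) sieved z y m * ((x %/ m < T) * count_sieved 0 z (x %/ m)) <=
  T * count_sieved z y x.
Proof.
rewrite mulnC /count_sieved big_distrl /=; apply: leq_sum => m _.
rewrite leq_mul2l; apply/orP; right; case: ltnP => // xT; rewrite mul1n.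
by apply: leq_trans (count_sieved_le _ _ _) _; apply: ltnW.
Qed.

(** If B were sparse in each of the fibres with T <= x / m <= z^U, it would be too
    small, as the other fibres together carry few smooth numbers. *)
Lemma good_fibre z y x T U M (B : pred nat) : z <= y -> 0 < T -> 0 < x ->
  (forall n, B n -> sieved 0 y n) ->
  count_sieved 0 y x <= M * count_in B 1 x.+1 ->
  4 * M * (\sum_(1 <= m < x.+1) sieved z y m * ((x %/ m < T) * count_sieved 0 z (x %/ m))) <=
    count_sieved 0 y x ->
  8 * M * (\sum_(1 <= m < x.+1) sieved z y m * ((z ^ U < x %/ m) * count_sieved 0 z (x %/ m))) <=
    count_sieved 0 y x ->
  exists m, [/\ 0 < m, T <= x %/ m <= z ^ U &
    count_sieved 0 z (x %/ m) <=
      2 * M * count_in (fun j => sieved 0 z j && B (m * j)) 1 (x %/ m).+1].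
Proof.
move=> zy T0 x0 By dense short long.
set N := count_sieved 0 y x in dense short long *.
pose Bm m := count_in (fun j => sieved 0 z j && B (m * j)) 1 (x %/ m).+1.
pose J m := count_sieved 0 z (x %/ m).
have BJ m : Bm m <= J m.
  by apply: leq_sum => j _; case: (sieved 0 z j); rewrite // leq_b1.
pose good m := T <= x %/ m <= z ^ U.
have [/hasP[m mI /andP[/andP[sm gm] h]]|/hasPn none] :=
   boolP (has (fun m => sieved z y m && good m && (J m <= 2 * M * Bm m)) (index_iota 1 x.+1)).
  by exists m; split=> //; move: mI; rewrite mem_index_iota => /andP[].
exfalso.
have N0 : 0 < N.
  by rewrite /N /count_sieved; apply: leq_trans (sum_pos _ (_ : 1 <= 1 < x.+1)).
have cB : count_in B 1 x.+1 = \sum_(1 <= m < x.+1) sieved z y m * Bm m.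
  transitivity (\sum_(1 <= n < x.+1) sieved 0 y n * B n).
    by apply: eq_bigr => n _; case: (boolP (B n)) => [/By ->|_]; rewrite ?muln0.
  rewrite (fibre_sum _ _ zy); apply: eq_bigr => m _; congr (_ * _).
  by apply: eq_bigr => j _; case: (sieved 0 z j); rewrite ?mul1n ?mul0n.
have cJ : N = \sum_(1 <= m < x.+1) sieved z y m * J m by exact: fibre_count.
have goodsum : 2 * M * (\sum_(1 <= m < x.+1) sieved z y m * (good m * Bm m)) +
    \sum_(1 <= m < x.+1) sieved z y m * good m <= N.
  rewrite cJ big_distrr /= -big_split /= big_nat_cond [leqRHS]big_nat_cond.
  apply: leq_sum => m /andP[mI _].
  have := none m; rewrite mem_index_iota mI => /(_ isT).
  case: (sieved z y m); rewrite ?muln0 ?mul0n // !mul1n /=.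
  case: (good m); rewrite ?mul0n ?muln0 // !mul1n /= -ltnNge.
  by rewrite addn1.
have splitB : count_in B 1 x.+1 <= \sum_(1 <= m < x.+1) sieved z y m * (good m * Bm m) +
   (\sum_(1 <= m < x.+1) sieved z y m * ((x %/ m < T) * J m) +
    \sum_(1 <= m < x.+1) sieved z y m * ((z ^ U < x %/ m) * J m)).
  rewrite cB -!big_split /=; apply: leq_sum => m _.
  case: (sieved z y m); rewrite ?mul0n // !mul1n /good.
  case: (leqP T (x %/ m)) => h1 /=; last by rewrite mul1n mul0n add0n; apply: leq_trans (BJ m) (leq_addr _ _).
  by case: (leqP (x %/ m) (z ^ U)) => h2; rewrite !(mul1n, mul0n) ?addn0 // add0n BJ.
have goodpos : 0 < \sum_(1 <= m < x.+1) sieved z y m * good m \/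
    \sum_(1 <= m < x.+1) sieved z y m * (good m * Bm m) = 0.
  case: (posnP (\sum_(1 <= m < x.+1) sieved z y m * good m)) => [g0|]; last by left.
  right; apply/eqP; rewrite sum_nat_seq_eq0; move/eqP: g0; rewrite sum_nat_seq_eq0.
  by apply: sub_all => m /=; rewrite !muln_eq0 => /orP[->|->] //; rewrite orbT.
move: dense short long goodsum splitB goodpos N0.
set b := count_in B 1 x.+1.
set s1 := \sum_(_ <= _ < _) _ * ((_ < T) * _); set s2 := \sum_(_ <= _ < _) _ * ((_ ^ _ < _) * _).
set g := \sum_(_ <= _ < _) _ * (good _ * _); set gg := \sum_(_ <= _ < _) _.
rewrite -!(mulnA _ M); clear; move=> d s l gs sp gp N0.
have e1 : M * b <= M * g + (M * s1 + M * s2) by rewrite -!mulnDr leq_mul2l sp orbT.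
by case: gp => [g0|g0]; [|rewrite g0 muln0 in e1 gs]; lia.
Qed.

(** U is chosen before T and z after T: Roth's theorem fixes T in terms of the
    density of the fibres, which depends on U. *)
Lemma fibre_parameters M : exists U, 24 <= U /\ forall T, exists z,
  [/\ 64 <= lg z,
      forall r s, lg z * r <= 2000 * s -> 4 * M * (T * r) <= s &
      forall r s, U * z * r <= (64000 * z + 2000 * U) * s -> 8 * M * r <= s].
Proof.
have large_lg a b c : exists z, [/\ a <= lg z, b <= lg z & c <= lg z].
  exists (2 ^ (a + b + c)); rewrite (trunc_expnK _ (isT : 1 < 2)).
  by split; lia.
exists (24 + 1024000 * M); split=> [|T]; first exact: leq_addr.
move E: (24 + 1024000 * M) => U.
have U0 : 0 < U by rewrite -E.
have UM : 1024000 * M <= U by rewrite -E leq_addl.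
have [z [z64 zT zM]] := large_lg 64 (8000 * M * T) (32000 * M).
have z0 : 0 < z by case: (z) z64; rewrite ?trunc_log0.
have zlg := ltn_lg z0.
exists z; split; first exact: z64.
  move=> r s rs; rewrite -(@leq_pmul2l 2000); last exact: isT.
  apply: leq_trans rs; rewrite (_ : 2000 * (4 * M * (T * r)) = (8000 * M * T) * r); last by ring.
  by rewrite leq_mul2r zT orbT.
move=> r s rs; have Uz : 0 < U * z by rewrite muln_gt0 U0.
rewrite -(leq_pmul2l Uz) mulnCA; apply: leq_trans (leq_mul (leqnn (8 * M)) rs) _.
rewrite mulnA leq_mul2r; apply/orP; right.
have h1 : z * (1024000 * M) <= z * U by rewrite leq_mul2l UM orbT.
have h2 : U * (32000 * M) <= U * z by rewrite leq_mul2l (leq_trans zM (ltnW zlg)) orbT.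
rewrite -(@leq_pmul2l 2); last exact: isT.
rewrite (_ : 2 * (8 * M * (64000 * z + 2000 * U)) = z * (1024000 * M) + U * (32000 * M)); last by ring.
by apply: leq_trans (leq_add h1 h2) _; rewrite (mulnC z) mul2n addnn.
Qed.

(** The parameters are fixed in the order U, T, z, K, each in terms of M and of
    the previous ones.  If log x < 128 log y, the smooth numbers have positive density
    in [1, x], and B itself is dense enough for Roth's theorem. *)
Theorem dense_smooth_ap (R : realType) M : 0 < M ->
  exists K x0, forall x y (B : pred nat), x0 <= x -> lg x ^ K <= y -> y <= x ->
    (forall n, B n -> sieved 0 y n) ->
    count_sieved 0 y x <= M * count_in B 1 x.+1 -> ~ ap_free B.
Proof.
move=> M0.
have [c1 c10 dens1] := smooth_density 256.
have c1M : 0 < c1 * M by rewrite muln_gt0 c10.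
have [T1 roth1] := roth_nat R c1M.
have [U [U24 parameters]] := fibre_parameters M.
have [c c0 dens] := smooth_density (2 * U).
have cM : 0 < c * (2 * M) by rewrite !muln_gt0 c0.
have [T' rothT] := roth_nat R cM.
pose T := T'.+1.
have [z [z64 zT zU]] := parameters T.
have z0 : 0 < z by case: (z) z64; rewrite ?trunc_log0.
have z4 : 0 < z ^ 4 by rewrite expn_gt0 z0.
have [K [y1 upper]] := count_sieved_div_upper 0 z4.
have [y2 sparse] := rough_sparse z0.
exists (maxn K 8), (2 ^ (y1 + y2 + z + 1) + T1) => x y B xx Ly yx By dense hB.
have x0 : 0 < x by apply: leq_trans xx; rewrite addn_gt0 expn_gt0.
have lx : y1 + y2 + z + 1 <= lg x.
  apply: (@trunc_log_max 2 x _ isT); exact: leq_trans (leq_addr _ _) xx.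
have lx0 : 0 < lg x by apply: leq_trans lx; rewrite addn1.
have lxy : lg x <= y by apply: leq_trans Ly; rewrite -{1}(expn1 (lg x)) leq_pexp2l // leq_max orbT.
have LK : lg x ^ K <= y by apply: leq_trans Ly; rewrite leq_pexp2l // leq_maxl.
have L8 : lg x ^ 8 <= y by apply: leq_trans Ly; rewrite leq_pexp2l // leq_maxr.
have [yy1 yy2 zy] : [/\ y1 <= y, y2 <= y & z <= y].
  by move: lx lxy; clear; split; lia.
have y64 : 64 <= lg y by apply: leq_trans z64 (leq_trunc_log 2 zy).
have [yL|yL] := leqP (128 * lg y) (lg x); last first.
  apply: (roth1 x B) hB; first by apply: leq_trans xx; rewrite leq_addl.
  have : x <= c1 * count_sieved 0 y x.
    apply: dens1 => //; apply: (@leq_trans ((y ^ 128) ^ 2)); last by rewrite -expnM.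
    rewrite leq_exp2r //; apply: ltnW; apply: leq_trans (lg_gt x) _.
    apply: (@leq_trans (2 ^ (128 * lg y))); first by rewrite leq_exp2l.
    have y_gt0 : 0 < y by apply: leq_trans zy.
    by rewrite mulnC expnM leq_exp2r // lg_le.
  by move/leq_trans; apply; rewrite -mulnA leq_mul2l dense orbT.
have up q : 0 < q <= z ^ 4 -> q * count_sieved 0 y (x %/ q) <= 1000 * count_sieved 0 y x.
  exact: upper.
have yL' : 24 * lg y <= lg x by apply: leq_trans yL; rewrite leq_mul2r orbT.
case: (@good_fibre z y x T U M B zy (ltn0Sn _) x0 By dense) => [| |m [m0 /andP[Tm mU] cm]].
- apply: leq_trans (leq_mul (leqnn (4 * M)) (short_fibres z y x T)) _.
  exact/zT/sparse.
- exact/zU/long_fibres.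
pose A j := sieved 0 z j && B (m * j).
apply: (rothT (x %/ m) A).
- exact: ltnW.
- apply: leq_trans (dens z (x %/ m) z64 _) _.
    apply: (@leq_trans ((z ^ U) ^ 2)); first by rewrite leq_exp2r.
    by rewrite -expnM mulnC.
  by rewrite -(mulnA c) leq_mul2l cm orbT.
- have := ap_free_affine (b := 0) m0 hB; apply: ap_free_sub => j /andP[_].
  by rewrite add0n.
Qed.

(** * Real parameters *)

Local Open Scope classical_set_scope.
Local Open Scope ring_scope.

Lemma card_set_count (A : set int) (X : nat) :
  (forall n, A n -> 0 < n /\ n <= X%:Z) ->
  card_set A = count_in (fun n => `[< A n%:Z >]) 1 X.+1.
Proof.
move=> AX; pose s := [seq Posz n | n <- index_iota 1 X.+1 & `[< A n%:Z >]].
have us : uniq s.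
  by rewrite map_inj_uniq ?filter_uniq ?iota_uniq // => m n [].
have sA n : (n \in s) = `[< A n >].
  apply/mapP/asboolP => [[m]|An].
    by rewrite mem_filter => /andP[/asboolP Am _] ->.
  have [n0 nX] := AX _ An; exists `|n|%N; last by rewrite gez0_abs // ltW.
  rewrite mem_filter mem_index_iota gez0_abs ?ltW //; apply/andP; split; first exact/asboolP.
  by move: n0 nX; clear; lia.
have fA : finite_set A.
  apply: (@sub_finite_set _ _ [set` s]); last exact: finite_seq.
  by move=> n An /=; rewrite sA; apply/asboolP.
have -> : card_set A = size s.
  rewrite /card_set -(undup_id us) -card_fseq; congr (#|` _|%fset).
  apply/fsetP => n; rewrite in_fset_set // inE sA.
  by apply/idP/asboolP => [/set_mem|/mem_set].
rewrite size_map size_filter /count_in -sum1_count big_mkcond /=.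
by apply: eq_bigr => n _; case: `[< _ >].
Qed.

Lemma smooth_sieved (R : realType) (y : R) (n : nat) : 0 <= y ->
  smooth y n%:Z <-> sieved 0 (Num.truncn y) n.
Proof.
move=> y0; split=> [[n0 H]|/sievedP[n0 H]].
  apply/sievedP; split; first by [].
  move=> p pp pn; rewrite prime_gt0 //= truncn_ge_nat //; apply: H => //.
split; first by [].
move=> p pp pn; rewrite -truncn_ge_nat //.
by have /andP[] := H p pp pn.
Qed.

Lemma Psi_count (R : realType) (x y : R) : 0 <= x -> 0 <= y ->
  Psi x y = count_sieved 0 (Num.truncn y) (Num.truncn x).
Proof.
move=> x0 y0; rewrite /Psi (@card_set_count _ (Num.truncn x)).
  rewrite /count_in /count_sieved big_nat_cond [RHS]big_nat_cond.
  apply: eq_bigr => n /andP[/andP[_ nx] _]; congr (nat_of_bool _).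
  apply/asboolP/idP => [[/(smooth_sieved _ y0)] //|sn]; split; first exact/smooth_sieved.
  by rewrite /= -pmulrn -truncn_ge_nat.
move=> n [[n0 _] /= nx]; split=> //.
move: n0 nx; case: n => // n _ nx; rewrite lez_nat truncn_ge_nat //.
Qed.

(** ln 2 >= 1/2, by convexity of the exponential. *)
Lemma lg_le_ln (R : realType) (x : R) : 1 <= x ->
  (trunc_log 2 (Num.truncn x))%:R <= 2 * ln x.
Proof.
move=> x1; have x0 : 0 < x by apply: lt_le_trans x1.
set l := trunc_log 2 _.
have h : (2 ^ l)%:R <= x.
  rewrite -truncn_ge_nat ?(ltW x0) //; apply: trunc_logP => //.
  by rewrite truncn_ge_nat ?(ltW x0).
have ln2 : 1 / 2 <= ln 2 :> R.
  rewrite -[leLHS]expRK ler_ln ?posrE ?expR_gt0 //.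
  rewrite -[1 / 2]opprK expRN -[leRHS]invrK lef_pV2 ?posrE ?expR_gt0 ?invr_gt0 //.
  by apply: le_trans (expR_ge1Dx _); lra.
have : ln ((2 ^ l)%:R : R) <= ln x.
  by rewrite ler_ln ?posrE // ltr0n expn_gt0.
rewrite natrX lnXn // -[_ *+ l]mulr_natr => h2.
have : l%:R * (1 / 2) <= l%:R * ln 2 :> R by rewrite ler_wpM2l.
by move: h2; clear; lra.
Qed.

Theorem corollary2 (R : realType) (beta : R) (hbeta : 0 < beta) :
  exists K : R, 0 < K /\
  exists x0 : R, forall x : R, x0 <= x ->
  forall y : R, (ln x) `^ K <= y -> y <= x ->
  forall B : set int,
    B `<=` smooth y `&` [set n : int | (1 : R) <= n%:~R <= x] ->
    beta * (Psi x y)%:R <= (card_set B)%:R ->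
    exists b d : int, d != 0 /\ [/\ B b, B (b + d) & B (b + 2 * d)].
Proof.
pose M := (Num.bound beta^-1).+1.
have MP : 1 <= M%:R * beta.
  rewrite -ler_pdivrMr // div1r; apply: ltW; apply: lt_trans (archi_boundP _) _.
    by rewrite invr_ge0 ltW.
  by rewrite ltr_nat.
have [K [X0 main]] := dense_smooth_ap R (isT : (0 < M)%N).
(* lg is at most 2 ln, and the power of 2 this costs is absorbed in one more factor
   ln x. *)
exists K.+1%:R; split=> //.
exists (X0%:R + expR (2 ^+ K)) => x xx y yK yx B By dense.
have e1 : 1 <= expR (2 ^+ K) :> R by rewrite -[leLHS]expR0 ler_expR exprn_ge0.
have X0x : X0%:R <= x by apply: le_trans xx; rewrite lerDl expR_ge0.
have ex : expR (2 ^+ K) <= x by apply: le_trans xx; rewrite lerDr.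
have x1 : 1 <= x by apply: le_trans ex.
have x_gt0 : 0 < x by apply: lt_le_trans x1.
have x_ge0 := ltW x_gt0.
have lnx : 2 ^+ K <= ln x by rewrite -[leLHS]expRK ler_ln ?posrE ?expR_gt0.
have lnx0 : 0 <= ln x by apply: le_trans lnx; rewrite exprn_ge0.
have y_ge0 : 0 <= y by apply: le_trans yK; exact: powR_ge0.
have lgK : (trunc_log 2 (Num.truncn x) ^ K <= Num.truncn y)%N.
  rewrite truncn_ge_nat // natrX; apply: le_trans yK; rewrite powR_mulrn //.
  apply: (@le_trans _ _ ((2 * ln x) ^+ K)).
    by rewrite lerXn2r ?nnegrE ?mulr_ge0 // lg_le_ln.
  by rewrite exprMn exprS ler_wpM2r // exprn_ge0.
pose Bn n := `[< B n%:Z >].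
have Bx n : B n -> 0 < n /\ n <= (Num.truncn x)%:Z.
  move=> /By [[n0 _] /= /andP[_ nx]]; split=> //.
  by move: n0 nx; case: n => // n _ nx; rewrite lez_nat truncn_ge_nat.
have dense' : (count_sieved 0 (Num.truncn y) (Num.truncn x) <= M * count_in Bn 1 (Num.truncn x).+1)%N.
  rewrite -(card_set_count Bx) -Psi_count // -(ler_nat R) natrM.
  apply: (@le_trans _ _ (M%:R * (beta * (Psi x y)%:R))); last by rewrite ler_wpM2l.
  by rewrite mulrA ler_peMl.
have Bs n : Bn n -> sieved 0 (Num.truncn y) n.
  by move=> /asboolP /By [/(smooth_sieved _ y_ge0)].
have XX : (X0 <= Num.truncn x)%N by rewrite truncn_ge_nat.
have YX : (Num.truncn y <= Num.truncn x)%N by rewrite le_truncn.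
have notfree := main _ _ Bn XX lgK YX Bs dense'.
apply: contrapT => none; apply: notfree => a d d0 /asboolP h1 /asboolP h2 /asboolP h3.
apply: none; exists a%:Z, d%:Z; split; first by rewrite eqz_nat -lt0n.
have -> : a%:Z + 2 * d%:Z = (a + d.*2)%:Z by rewrite -mul2n PoszD PoszM.
by split=> //; rewrite -PoszD.
Qed.
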